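(* The geodesic equation $D_tu'=0$ for the Calabi metric on $\mathcal C$ is equivalent to an ordinary differential equation, namely to the equation $$(e^{\frac u2})_{tt}+e^{\frac u2}=0.$$
   Context: Let $(M,\omega)$ be a closed Kähler manifold of complex dimension $n$, $\mathrm{Vol}=\int_M\frac{\omega^n}{n!}$, and $\mathcal C=\{u\in C^\infty(M,\mathbb R): \int_M e^u\frac{\omega^n}{n!}=\int_M\frac{\omega^n}{n!}\}$ (the space of Kähler metrics, parametrized by volume conformal factors). A smooth curve in $\mathcal C$ is a map $u=u(t)$ from an open interval to $\mathcal C$ such that $(t,p)\mapsto u(t)(p)$ is smooth. The tangent space is $T_u\mathcal C=\{v\in C^\infty(M,\mathbb R):\int_M v e^u\frac{\omega^n}{n!}=0\}$. The Calabi metric is $\langle v,w\rangle_u=\int_M vw\,e^u\frac{\omega^n}{n!}$ for $v,w\in T_u\mathcal C$. Its Levi Civita covariant derivative of a smooth section $v$ along a smooth curve $u$ (a smooth $v(t,p)$ with $v(t,\cdot)\in T_{u(t)}\mathcal C$) is $D_tv=v'+\frac12vu'+\frac1{2\mathrm{Vol}}\int_Mvu'e^u\frac{\omega^n}{n!}$, where $'=\partial/\partial t$. A geodesic is a smooth curve $u$ in $\mathcal C$ satisfying the geodesic equation $D_tu'=0$. The subscript $tt$ denotes the second derivative in $t$.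
   Formalization: Constant curves are geodesics but do not solve the equation, so it is proved equivalent to being a geodesic with squared speed 4Vol; a curve is a nonconstant geodesic iff some rescaling u(cs), c>0, solves it. *)

(* Defs.v *)
(* Differential geometry is not available in MathComp-Analysis, so this file
   sets up closed Kaehler manifolds by local coordinates.  Points and vectors
   of R^m are row vectors, and a linear map v |-> v *m A acts on the right.
   The coordinates of C^n = R^(2n) are interleaved: x_j is the coordinate of
   index 2j and y_j the one of index 2j+1, where z_j = x_j + i y_j.  Ordered
   in this way they are positively oriented for the complex orientation. *)
From HB Require Import structures.
From mathcomp Require Import all_boot all_order all_algebra all_fingroup.
From mathcomp Require Import all_classical all_reals all_analysis.

Set Implicit Arguments.
Unset Strict Implicit.
Unset Printing Implicit Defensive.

Import Order.TTheory GRing.Theory Num.Theory.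
Import numFieldNormedType.Exports.

Local Open Scope classical_set_scope.
Local Open Scope ring_scope.

Section Calculus.
Context {R : realType}.

Definition along {m} (f : 'rV[R]_m -> R) (a : 'I_m) (x : 'rV[R]_m) : R -> R :=
  fun h => f (x + h *: delta_mx 0 a).

Definition partial {m} (f : 'rV[R]_m -> R) (a : 'I_m) (x : 'rV[R]_m) : R :=
  derive1 (along f a x) 0.

(* The functions of class C^k on D, for an open set D. *)
Fixpoint Ck {m} (k : nat) (D : set 'rV[R]_m) (f : 'rV[R]_m -> R) : Prop :=
  (forall x, D x -> {for x, continuous f}) /\
  (if k is k'.+1 then
     forall a, (forall x, D x -> derivable (along f a x) 0 1) /\
               Ck k' D (partial f a)
   else True).

Definition smooth_on {m} (D : set 'rV[R]_m) (f : 'rV[R]_m -> R) : Prop :=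
  forall k, Ck k D f.

(* Transposed Jacobian matrix: the differential of F at x maps the row vector
   v to v *m jacobian F x. *)
Definition jacobian {m p} (F : 'rV[R]_m -> 'rV[R]_p) (x : 'rV[R]_m) :
    'M[R]_(m, p) :=
  \matrix_(a, b) partial (fun y => F y 0 b) a x.

(* Lebesgue integral over R^m, one coordinate after the other.  It is only
   applied below to continuous functions with compact support. *)
Fixpoint integral_rV (m : nat) : ('rV[R]_m -> R) -> R :=
  match m with
  | 0 => fun f => f 0
  | m'.+1 => fun f =>
      (\int[lebesgue_measure]_(s in [set: R])
         integral_rV (fun y : 'rV[R]_m' => f (row_mx (s%:M : 'rV[R]_1) y)))%R
  end.

End Calculus.

Section ComplexCoordinates.
Context {R : realType} {n : nat}.

Fact xidx_subproof (j : 'I_n) : (j.*2 < n.*2)%N.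
Proof. by rewrite ltn_double. Qed.

Fact yidx_subproof (j : 'I_n) : (j.*2.+1 < n.*2)%N.
Proof. by rewrite ltn_Sdouble. Qed.

Definition xidx (j : 'I_n) : 'I_n.*2 := Ordinal (xidx_subproof j).
Definition yidx (j : 'I_n) : 'I_n.*2 := Ordinal (yidx_subproof j).

(* Multiplication by i: v *m cstruct sends d/dx_j to d/dy_j and d/dy_j to
   - d/dx_j. *)
Definition cstruct : 'M[R]_n.*2 :=
  \sum_(j < n) (delta_mx (xidx j) (yidx j) - delta_mx (yidx j) (xidx j)).

(* Smooth and satisfying the Cauchy-Riemann equations. *)
Definition holomorphic_on (D : set 'rV[R]_n.*2)
    (F : 'rV[R]_n.*2 -> 'rV[R]_n.*2) : Prop :=
  (forall b, smooth_on D (fun x => F x 0 b)) /\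
  (forall x, D x -> cstruct *m jacobian F x = jacobian F x *m cstruct).

(* For the alternating form w(v, w) = v *m W *m w^T on R^(2n), the value of
   w^n / n! on the frame (d/dx_1, d/dy_1, ..., d/dx_n, d/dy_n), that is, the
   coefficient of dx_1 dy_1 ... dx_n dy_n in w^n / n!.  The factor 2^-n is the
   one in (w ^ w')(v_1, ..., v_4) = 1/(2! 2!) \sum_s sgn(s) ... *)
Definition top_coef (W : 'M[R]_n.*2) : R :=
  (2 ^ n * n`!)%:R^-1 *
  \sum_(s : 'S_n.*2) (-1) ^+ s * \prod_(j < n) W (s (xidx j)) (s (yidx j)).

End ComplexCoordinates.

(* A nonempty compact complex manifold (without boundary), given by a
   holomorphic atlas.  chart_inv i is only relevant on chart_img i. *)
Record closedComplexManifold (R : realType) (n : nat) := ClosedComplexManifold {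
  carrier :> topologicalType;
  carrier_neq0 : [set: carrier] !=set0;
  carrier_hausdorff : hausdorff_space carrier;
  carrier_compact : compact [set: carrier];
  chart_idx : Type;
  chart_dom : chart_idx -> set carrier;
  chart : chart_idx -> carrier -> 'rV[R]_n.*2;
  chart_inv : chart_idx -> 'rV[R]_n.*2 -> carrier;
  chart_img := fun i => chart i @` chart_dom i;
  chart_dom_open : forall i, open (chart_dom i);
  chart_img_open : forall i, open (chart_img i);
  chart_cover : forall p, exists i, chart_dom i p;
  chartK : forall i p, chart_dom i p -> chart_inv i (chart i p) = p;
  chart_continuous : forall i p, chart_dom i p -> {for p, continuous (chart i)};
  chart_inv_continuous : forall i x, chart_img i x ->
    {for x, continuous (chart_inv i)};
  transition_holomorphic : forall i j,
    holomorphic_on (chart i @` (chart_dom i `&` chart_dom j))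
                   (chart j \o chart_inv i) }.

Section KaehlerForm.
Context {R : realType} {n : nat} (M : closedComplexManifold R n).

(* omega i x is the matrix, in the coordinate frame of the chart i, of the
   2-form w at the point of coordinates x. *)
Record is_kaehler_form
    (omega : chart_idx M -> 'rV[R]_n.*2 -> 'M[R]_n.*2) : Prop := {
  kform_smooth : forall i a b, smooth_on (chart_img i) (fun x => omega i x a b);
  kform_pullback : forall i j x,
    (chart i @` (chart_dom i `&` chart_dom j)) x ->
    let F := chart j \o chart_inv i in
    omega i x = jacobian F x *m omega j (F x) *m (jacobian F x)^T;
  kform_alternating : forall i x, chart_img i x -> (omega i x)^T = - omega i x;
  kform_closed : forall i x, chart_img i x -> forall a b c,
    partial (fun y => omega i y b c) a x +
    partial (fun y => omega i y c a) b x +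
    partial (fun y => omega i y a b) c x = 0;
  (* w(J v, J w) = w(v, w) *)
  kform_invariant : forall i x, chart_img i x ->
    cstruct *m omega i x *m cstruct^T = omega i x;
  (* w(v, J v) > 0 *)
  kform_positive : forall i x, chart_img i x -> forall v : 'rV[R]_n.*2,
    v != 0 -> 0 < (v *m omega i x *m (v *m cstruct)^T) 0 0 }.

End KaehlerForm.

Record closedKaehlerManifold (R : realType) (n : nat) := ClosedKaehlerManifold {
  kmanifold :> closedComplexManifold R n;
  kform : chart_idx kmanifold -> 'rV[R]_n.*2 -> 'M[R]_n.*2;
  kformP : is_kaehler_form kform }.

Section Calabi.
Context {R : realType} {n : nat} {M : closedKaehlerManifold R n}.
Implicit Types (f v w : M -> R) (I : set R) (u : R -> M -> R).

Definition smooth f : Prop :=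
  forall i : chart_idx M, smooth_on (chart_img i) (f \o chart_inv i).

(* Smoothness of (t, p) |-> u t p on I x M; the time is the first coordinate
   of R^(1 + 2n). *)
Definition jointly_smooth I u : Prop :=
  forall i : chart_idx M, smooth_on
    [set y : 'rV[R]_(1 + n.*2) | I (y 0 0) /\ chart_img i (rsubmx y)]
    (fun y => u (y 0 0) (chart_inv i (rsubmx y))).

(* Finite smooth partition of unity subordinate to the atlas. *)
Record partition_of_unity := PartitionOfUnity {
  pou_size : nat;
  pou_idx : 'I_pou_size -> chart_idx M;
  pou_fun : 'I_pou_size -> M -> R;
  pou_smooth : forall k, smooth (pou_fun k);
  pou_ge0 : forall k p, 0 <= pou_fun k p;
  pou_supp : forall k,
    closure [set p | pou_fun k p != 0] `<=` chart_dom (pou_idx k);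
  pou_sum1 : forall p, \sum_k pou_fun k p = 1 }.

Variable P : partition_of_unity.

(* The integral of f w^n / n! over M, computed with the partition of unity P
   (its value for a continuous f does not depend on P). *)
Definition integral_kform f : R :=
  \sum_(k < pou_size P) integral_rV
    ((fun x => let p := chart_inv (pou_idx k) x in
               pou_fun k p * f p * top_coef (kform (pou_idx k) x))
     \_ (chart_img (pou_idx k))).

Definition Vol : R := integral_kform (fun=> 1).

Definition Cspace : set (M -> R) :=
  [set f | smooth f /\ integral_kform (fun p => expR (f p)) = Vol].

Definition smooth_curve I u : Prop :=
  (forall t, I t -> Cspace (u t)) /\ jointly_smooth I u.

Definition calabi f v w : R :=
  integral_kform (fun p => v p * w p * expR (f p)).

Definition dt u : R -> M -> R := fun t p => derive1 (u ^~ p) t.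

(* D_t v along the curve u *)
Definition covD u (v : R -> M -> R) : R -> M -> R := fun t p =>
  dt v t p + 2^-1 * v t p * dt u t p +
  (2 * Vol)^-1 * integral_kform (fun q => v t q * dt u t q * expR (u t q)).

Definition geodesic I u : Prop :=
  smooth_curve I u /\ forall t, I t -> forall p, covD u (dt u) t p = 0.

(* The solutions in the space C have the constant speed 2 sqrt(Vol), whereas a
   geodesic may have any constant speed (constant curves are geodesics): the
   equation describes geodesics up to a linear change of time. *)
Definition calabi_ode I u : Prop := forall t, I t -> forall p,
  derive1n 2 (fun s => expR (u s p / 2)) t + expR (u t p / 2) = 0.

End Calabi.

(* Main.v *)
(* With w = e^(u/2) the geodesic equation reads w'' = - q(t) w, where q(t), the
   squared speed of the curve divided by 4 Vol, is the same at every point.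
   All functions t |-> w(t, p) thus solve the same linear equation of order two:
   their Wronskians are constant and w(t, p) = a(p) f(t) + b(p) g(t).  The
   integral of w^2 is then a quadratic form in (f, g), constant equal to Vol, and
   differentiating it twice shows that the squared speed is 4 q Vol and that q is
   constant, whatever the function q.  So a geodesic solves w'' = - q w with q a
   constant, which is positive unless the curve is constant, and a change of time
   brings it to q = 1; conversely a solution of w'' = - q w with q constant has
   the speed that makes it a geodesic.
   This needs Vol > 0, that is, that omega^n is a positive multiple of the
   coordinate volume form.  Eliminating one pair of coordinates after
   the other by Schur complements (congruences of determinant one) reduces the
   matrix of omega to a form in which all terms of the Pfaffian are nonnegative. *)
Require Import Defs.
From mathcomp Require Import all_boot all_order all_algebra all_fingroup.
From mathcomp Require Import all_classical all_reals all_analysis.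
From mathcomp Require Import ring lra.
Import Order.TTheory GRing.Theory Num.Theory.
Import numFieldNormedType.Exports.
Local Open Scope classical_set_scope.
Local Open Scope ring_scope.

(** * Pfaffians and the positivity of the volume form *)

Section Pfaffian.
Set Implicit Arguments.
Unset Strict Implicit.
Context {R : realType}.

Lemma big_xyidx n (F : 'I_n.*2 -> R) :
  \prod_i F i = \prod_(j < n) (F (xidx j) * F (yidx j)).
Proof.
elim: n F => [|n IHn] F; first by rewrite !big_ord0.
rewrite !big_ord_recl mulrA IHn; congr (_ * _ * _).
- by congr F; apply: val_inj.
- by congr F; apply: val_inj.
by apply: eq_bigr => j _; congr (F _ * F _); apply: val_inj.
Qed.

Definition pair_of n (i : 'I_n.*2) : 'I_n.
Proof. by exists i./2; rewrite ltn_half_double. Defined.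

Lemma pair_xidx n (j : 'I_n) : pair_of (xidx j) = j.
Proof. by apply: val_inj; rewrite /= doubleK. Qed.

Lemma pair_yidx n (j : 'I_n) : pair_of (yidx j) = j.
Proof. by apply: val_inj; rewrite /= -/(uphalf _) uphalf_double. Qed.

Lemma pair_ofK n (i : 'I_n.*2) :
  i = if odd i then yidx (pair_of i) else xidx (pair_of i).
Proof.
by apply: val_inj; rewrite -[LHS]odd_double_half; case: (odd i).
Qed.

Lemma odd_xidx n (j : 'I_n) : odd (xidx j) = false.
Proof. by rewrite /= odd_double. Qed.

Lemma odd_yidx n (j : 'I_n) : odd (yidx j).
Proof. by rewrite /= odd_double. Qed.

Definition pfaff_term n (W : 'M[R]_n.*2) (s : 'S_n.*2) : R :=
  (-1) ^+ s * \prod_(j < n) W (s (xidx j)) (s (yidx j)).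

(** For alternating [W] this is 2^n n! times the Pfaffian, the factor that [top_coef] divides
    out. *)
Definition pfaff n (W : 'M[R]_n.*2) : R := \sum_s pfaff_term W s.

(** Leibniz expansion for a choice [f] of columns of [A], possibly with repetitions, which make the
    determinant vanish. *)
Lemma det_fun n (A : 'M[R]_n) (f : 'I_n -> 'I_n) :
  \sum_(s : 'S_n) (-1) ^+ s * \prod_i A (s i) (f i) =
  \det (\matrix_(i, k) A k (f i)).
Proof.
by apply: eq_bigr => s _; congr (_ * _); apply: eq_bigr => i _; rewrite mxE.
Qed.

(** As for the multiplicativity of the determinant: expanding the entries of [A *m W *m A^T] turns
    the sum over [s] into a sum over all maps [f] of indices, each weighted by the determinant of
    the columns of [A] chosen by [f]. This vanishes unless [f] is a permutation, when it is a sign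
    times [\det A]. *)
Lemma pfaff_congruence n (A W : 'M[R]_n.*2) :
  pfaff (A *m W *m A^T) = \det A * pfaff W.
Proof.
pose I2 := 'I_n.*2.
(* [f_] and [g_] identify a choice of an index pair for each j with a map on all 2n indices. *)
pose f_ (g : {ffun 'I_n -> I2 * I2}) : {ffun I2 -> I2} :=
  [ffun i : I2 => if odd i then (g (pair_of i)).2 else (g (pair_of i)).1].
pose g_ (f : {ffun I2 -> I2}) : {ffun 'I_n -> I2 * I2} :=
  [ffun j : 'I_n => (f (xidx j), f (yidx j))].
have g_K : cancel g_ f_.
  move=> f; apply/ffunP => i; rewrite !ffunE /=.
  by move: (pair_ofK i); case: (odd i) => /= <-.
have f_K : cancel f_ g_.
  move=> g; apply/ffunP => j; rewrite !ffunE odd_xidx odd_yidx.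
  by rewrite pair_xidx pair_yidx -surjective_pairing.
transitivity (\sum_(f : {ffun I2 -> I2})
    (\prod_(j < n) W (f (xidx j)) (f (yidx j))) *
    \det (\matrix_(i < n.*2, k < n.*2) A k (f i))).
  transitivity (\sum_(g : {ffun 'I_n -> I2 * I2})
     (\prod_(j < n) W (g j).1 (g j).2) *
    \det (\matrix_(i < n.*2, k < n.*2) A k (f_ g i))); last first.
    rewrite (reindex g_) /=; last by exists f_ => x _; [apply: g_K | apply: f_K].
    apply: eq_bigr => f _; rewrite g_K; congr (_ * _).
    by apply: eq_bigr => j _; rewrite ffunE.
  transitivity (\sum_(g : {ffun 'I_n -> I2 * I2})
     \sum_(s : 'S_n.*2) (\prod_(j < n) W (g j).1 (g j).2) *
       ((-1) ^+ s * \prod_i A (s i) (f_ g i))); last first.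
    by apply: eq_bigr => g _; rewrite -det_fun mulr_sumr.
  rewrite exchange_big; apply: eq_bigr => s _.
  under eq_bigr do rewrite mulrCA.
  rewrite -mulr_sumr; congr (_ * _).
  pose F j (kl : I2 * I2) :=
    W kl.1 kl.2 * (A (s (xidx j)) kl.1 * A (s (yidx j)) kl.2).
  transitivity (\prod_(j < n) \sum_(kl : I2 * I2) F j kl).
    apply: eq_bigr => j _; rewrite mxE.
    under eq_bigr do rewrite mxE mulr_suml.
    rewrite exchange_big pair_big /=.
    by apply: eq_bigr => -[k l] _; rewrite /F mxE /=; ring.
  rewrite bigA_distr_bigA; apply: eq_bigr => g _.
  rewrite big_split big_xyidx; congr (_ * _); apply: eq_bigr => j _.
  by rewrite !ffunE odd_xidx odd_yidx pair_xidx pair_yidx.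
rewrite (bigID (fun f : {ffun I2 -> I2} => injectiveb f)) /= addrC big1 ?add0r.
  rewrite (reindex (@pval _)) /=; last first.
    pose in_Sn := insubd (1%g : 'S_(n.*2)).
    by exists in_Sn => /= f Uf; first apply: val_inj; apply: insubdK.
  rewrite mulr_sumr; apply: eq_big => [s|s _]; first exact: (valP s).
  have -> : (\matrix_(i < n.*2, k < n.*2) A k (pval s i)) = row_perm s A^T.
    by apply/matrixP => i k; rewrite !mxE pvalE.
  rewrite row_permE det_mulmx det_perm det_tr /pfaff_term [LHS]mulrC mulrAC.
  by rewrite mulrC; congr (_ * (_ * _)); apply: eq_bigr => j _; rewrite pvalE.
move=> f /injectivePn [i [k neq_ik eq_f]].
rewrite (determinant_alternate neq_ik) ?mulr0// => l.
by rewrite !mxE eq_f.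
Qed.


Lemma idxP n (i : 'I_n.*2) : exists j, i = xidx j \/ i = yidx j.
Proof.
by exists (pair_of i); move: (pair_ofK i); case: (odd i) => <-; [right | left].
Qed.

Lemma eq_xidx n (j k : 'I_n) : (xidx j == xidx k) = (j == k).
Proof. by apply/eqP/eqP => [/(congr1 (@pair_of n))|->//]; rewrite !pair_xidx. Qed.

Lemma eq_yidx n (j k : 'I_n) : (yidx j == yidx k) = (j == k).
Proof. by apply/eqP/eqP => [/(congr1 (@pair_of n))|->//]; rewrite !pair_yidx. Qed.

Lemma eq_xyidx n (j k : 'I_n) : (xidx j == yidx k) = false.
Proof.
by apply/eqP => /(congr1 (fun i : 'I_n.*2 => odd i)); rewrite odd_xidx odd_yidx.
Qed.

(** The exchange of x_j and y_j reverses the sign of the permutation and, as [W] is alternating,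
    that of one factor. *)
Lemma pfaff_term_flip n (W : 'M[R]_n.*2) (s : 'S_n.*2) (j : 'I_n) :
  W^T = - W ->
  pfaff_term W (tperm (xidx j) (yidx j) * s)%g = pfaff_term W s.
Proof.
move=> altW; have Wyx i k : W i k = - W k i.
  by have /matrixP/(_ k i) := altW; rewrite !mxE.
rewrite /pfaff_term odd_permM odd_tperm eq_xyidx /= signrN.
rewrite (bigD1 j) //= [in RHS](bigD1 j) //= !permM tpermL tpermR.
rewrite (Wyx (s (yidx j))) !mulNr mulrN opprK.
by congr (_ * (_ * _)); apply: eq_bigr => k neq_kj; rewrite !permM !tpermD //
  ?eq_xidx ?eq_yidx ?eq_xyidx 1?eq_sym ?eq_xyidx // eq_sym.
Qed.

(* [s] is the product of its action on the x's and of its action on the y's,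
   which are conjugate by the exchange of the x's and the y's. *)
Lemma odd_double_perm n (s : 'S_n.*2) (t : 'I_n -> 'I_n) :
  (forall j, s (xidx j) = xidx (t j)) -> (forall j, s (yidx j) = yidx (t j)) ->
  odd_perm s = false.
Proof.
move=> sx sy.
have inj_t : injective t.
  by move=> j k eq_t; apply/eqP; rewrite -eq_xidx -(inj_eq (@perm_inj _ s)) !sx eq_t.
pose f1 (i : 'I_n.*2) := if odd i then i else s i.
pose f2 (i : 'I_n.*2) := if odd i then s i else i.
pose th (i : 'I_n.*2) := if odd i then xidx (pair_of i) else yidx (pair_of i).
have f1x j : f1 (xidx j) = xidx (t j) by rewrite /f1 odd_xidx sx.
have f1y j : f1 (yidx j) = yidx j by rewrite /f1 odd_yidx.
have f2x j : f2 (xidx j) = xidx j by rewrite /f2 odd_xidx.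
have f2y j : f2 (yidx j) = yidx (t j) by rewrite /f2 odd_yidx sy.
have thx j : th (xidx j) = yidx j by rewrite /th odd_xidx pair_xidx.
have thy j : th (yidx j) = xidx j by rewrite /th odd_yidx pair_yidx.
have inj1 : injective f1.
  move=> i k; have [j [->|->]] := idxP i; have [l [->|->]] := idxP k;
  rewrite ?f1x ?f1y => /eqP; rewrite ?eq_xidx ?eq_yidx ?eq_xyidx //
    1?eq_sym ?eq_xyidx // => /eqP eq_jl;
  by [rewrite eq_jl | rewrite (inj_t _ _ eq_jl)].
have inj2 : injective f2.
  move=> i k; have [j [->|->]] := idxP i; have [l [->|->]] := idxP k;
  rewrite ?f2x ?f2y => /eqP; rewrite ?eq_xidx ?eq_yidx ?eq_xyidx //
    1?eq_sym ?eq_xyidx // => /eqP eq_jl;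
  by [rewrite eq_jl | rewrite (inj_t _ _ eq_jl)].
have injth : injective th.
  by apply: (can_inj (g := th)) => i; have [j [->|->]] := idxP i; rewrite ?(thx, thy).
have -> : s = (perm inj1 * perm inj2)%g.
  apply/permP => i; rewrite permM !permE; have [j [->|->]] := idxP i.
    by rewrite f1x f2x.
  by rewrite f1y f2y.
have -> : perm inj2 = (perm inj1 ^ perm injth)%g.
  apply/permP => i; have [k ->] : exists k, i = perm injth k.
    by exists (iinv (perm_onto (perm injth) i)); rewrite f_iinv.
  rewrite permJ !permE; have [j [->|->]] := idxP k.
    by rewrite thx f1x thx f2y.
  by rewrite thy f1y thy f2x.
by rewrite odd_permM odd_permJ addbb.
Qed.

Definition pair_diag n (D : 'M[R]_n.*2) : Prop :=
  forall i k, pair_of i != pair_of k -> D i k = 0.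

(** A nonzero term comes from an [s] that permutes the pairs. Flipping a pair that [s] sends in
    reversed order keeps the term and lowers the number of odd [s (xidx j)]. Once there is none, [s]
    acts alike on the x's and the y's, hence is even, and the term is a product of positive
    entries. *)
Lemma pfaff_term_ge0 n (D : 'M[R]_n.*2) (s : 'S_n.*2) :
  D^T = - D -> pair_diag D -> (forall j, 0 < D (xidx j) (yidx j)) ->
  0 <= pfaff_term D s.
Proof.
move=> altD diagD D_gt0.
have [N] := ubnP #|[pred j | odd (s (xidx j))]|.
elim: N s => // N IHN s leN.
have [/forallP pair_s|] :=
    boolP [forall j, pair_of (s (xidx j)) == pair_of (s (yidx j))]; last first.
  rewrite negb_forall => /existsP [j neq_j].
  by rewrite /pfaff_term (bigD1 j) //= diagD // mul0r mulr0.
have odd_s j : odd (s (yidx j)) = ~~ odd (s (xidx j)).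
  have := eq_xyidx j j; rewrite -(inj_eq (@perm_inj _ s)).
  rewrite {1}(pair_ofK (s (xidx j))) {1}(pair_ofK (s (yidx j))).
  rewrite (eqP (pair_s j)).
  by case: (odd _); case: (odd _); rewrite ?eqxx.
have [/existsP [j odd_sj]|] := boolP [exists j, odd (s (xidx j))].
  rewrite -(pfaff_term_flip s j altD); apply: IHN.
  rewrite ltnS in leN; apply: leq_trans leN; apply: proper_card.
  apply/properP; split; last first.
    by exists j; rewrite !inE //= permM tpermL odd_s odd_sj.
  apply/fintype.subsetP => k; rewrite !inE permM; have [->|neq_kj] := eqVneq k j.
    by rewrite odd_sj.
  by rewrite tpermD // ?eq_xidx 1?eq_sym ?eq_xyidx // eq_sym.
rewrite negb_exists => /forallP even_s.
have sx j : s (xidx j) = xidx (pair_of (s (xidx j))).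
  by have := pair_ofK (s (xidx j)); rewrite (negbTE (even_s j)).
have sy j : s (yidx j) = yidx (pair_of (s (xidx j))).
  by have := pair_ofK (s (yidx j)); rewrite odd_s even_s (eqP (pair_s j)).
rewrite /pfaff_term (odd_double_perm sx sy) mul1r.
by apply: prodr_ge0 => j _; rewrite sx sy ltW.
Qed.

Lemma pfaff_pair_diag_gt0 n (D : 'M[R]_n.*2) :
  D^T = - D -> pair_diag D -> (forall j, 0 < D (xidx j) (yidx j)) ->
  0 < pfaff D.
Proof.
move=> altD diagD D_gt0; rewrite /pfaff (bigD1 1%g) //=.
apply: ltr_wpDr; first by apply: sumr_ge0 => s _; exact: pfaff_term_ge0.
rewrite /pfaff_term odd_perm1 mul1r; apply: prodr_gt0 => j _.
by rewrite !perm1.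
Qed.

(** * The complex structure and the reduction of compatible forms *)

Lemma cstructE n (p q : 'I_n.*2) : @cstruct R n p q =
  (pair_of p == pair_of q)%:R * ((odd q)%:R - (odd p)%:R).
Proof.
rewrite /cstruct summxE (bigD1 (pair_of p)) //= big1 ?addr0; last first.
  move=> j neq_jp; rewrite !mxE.
  have neqx i : (i == xidx j) = (i == xidx j) && (j == pair_of i).
    by case: eqP => // ->; rewrite pair_xidx eqxx.
  have neqy i : (i == yidx j) = (i == yidx j) && (j == pair_of i).
    by case: eqP => // ->; rewrite pair_yidx eqxx.
  by rewrite (neqx p) (neqy p) (negbTE neq_jp) !andbF subrr.
rewrite !mxE; have [j [->|->]] := idxP p; have [k [->|->]] := idxP q;
  rewrite ?odd_xidx ?odd_yidx ?pair_xidx ?pair_yidx ?eq_xidx ?eq_yidx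
    ?eq_xyidx ?eqxx /= ?[yidx _ == xidx _]eq_sym ?eq_xyidx /= ?subrr ?mulr0 //.
  by rewrite !subr0 mulr1 eq_sym.
by rewrite !sub0r eq_sym mulrN1.
Qed.

(** The conditions on a Kaehler form at one point: positivity of the volume form becomes linear
    algebra. *)
Definition compatible n (W : 'M[R]_n.*2) : Prop :=
  [/\ W^T = - W, cstruct *m W *m cstruct^T = W &
      forall v : 'rV[R]_n.*2,
        v != 0 -> 0 < (v *m W *m (v *m cstruct)^T) 0 0].

(** Positivity at d/dx_j, which the complex structure sends to d/dy_j. *)
Lemma compatible_xy_gt0 n (W : 'M[R]_n.*2) j :
  compatible W -> 0 < W (xidx j) (yidx j).
Proof.
case=> _ _ /(_ (delta_mx 0 (xidx j))).
have -> : delta_mx 0 (xidx j) *m cstruct = delta_mx 0 (yidx j) :> 'rV[R]_n.*2.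
  apply/rowP => q; rewrite -rowE !mxE cstructE pair_xidx odd_xidx subr0.
  have [k [->|->]] := idxP q.
    by rewrite odd_xidx mulr0 eq_xyidx.
  by rewrite odd_yidx mulr1 pair_yidx eq_yidx eq_sym.
rewrite -rowE trmx_delta -colE !mxE; apply.
by apply/eqP => /rowP /(_ (xidx j)); rewrite !mxE !eqxx => /eqP; rewrite oner_eq0.
Qed.

Definition cstruct1 : 'M[R]_2 := \matrix_(p, q) ((odd q)%:R - (odd p)%:R).

Lemma cstruct1_sqr : cstruct1 *m cstruct1 = - 1%:M.
Proof.
apply/matrixP => p q; rewrite !mxE !big_ord_recl big_ord0 !mxE /=.
by case: p => -[|[|//]] ? /=; case: q => -[|[|//]] ? /=;
  rewrite ?mulr1n ?mulr0n /=; ring.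
Qed.

Lemma tr_cstruct1 : cstruct1^T = - cstruct1.
Proof. by apply/matrixP => p q; rewrite !mxE opprB. Qed.

Lemma pair_lshift n (p : 'I_2) : pair_of (lshift n.*2 p : 'I_n.+1.*2) = ord0.
Proof. by apply: val_inj; case: p => -[|[|//]]. Qed.

Lemma pair_rshift n (p : 'I_n.*2) :
  pair_of (rshift 2 p : 'I_n.+1.*2) = lift ord0 (pair_of p).
Proof. exact: val_inj. Qed.

Lemma cstruct_block n :
  @cstruct R n.+1 = block_mx cstruct1 0 0 cstruct :> 'M[R]_(2 + n.*2).
Proof.
apply/matrixP => p q; have [i ->|i ->] := split_ordP p; have [k ->|k ->] := split_ordP q.
- by rewrite block_mxEul [LHS]cstructE !pair_lshift eqxx mul1r mxE.
- by rewrite block_mxEur [LHS]cstructE pair_lshift pair_rshift mul0r mxE.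
- by rewrite block_mxEdl [LHS]cstructE pair_lshift pair_rshift mul0r mxE.
- rewrite block_mxEdr [LHS]cstructE [RHS]cstructE !pair_rshift (inj_eq lift_inj) /=.
  by rewrite !negbK.
Qed.

Lemma alternating_mx2 (B : 'M[R]_2) : B^T = - B -> B = B 0 1 *: cstruct1.
Proof.
move=> altB; have Bqp i k : B i k = - B k i.
  by have /matrixP/(_ k i) := altB; rewrite !mxE.
have B0 i : B i i = 0 by have := Bqp i i; lra.
apply/matrixP => p q; rewrite !mxE.
have [->|->] : p = 0 \/ p = 1.
- by case: p => -[|[|//]] ?; [left|right]; apply: val_inj.
- have [->|->] : q = 0 \/ q = 1.
  - by case: q => -[|[|//]] ?; [left|right]; apply: val_inj.
  - by rewrite B0 /= subrr mulr0.
  - by rewrite /= subr0 mulr1.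
have [->|->] : q = 0 \/ q = 1.
- by case: q => -[|[|//]] ?; [left|right]; apply: val_inj.
- by rewrite Bqp /= sub0r mulrN1.
- by rewrite B0 /= subrr mulr0.
Qed.

(* The Schur complement of the first diagonal block: the congruence is
   unipotent and commutes with the complex structure, so that compatibility
   passes to the complement. *)
Lemma compatible_schur n (W : 'M[R]_(n.+1.*2)) : compatible W ->
  exists (B : 'M[R]_(n.+1.*2)) (a : R) (S : 'M[R]_n.*2),
    [/\ \det B = 1, 0 < a, compatible S &
        B *m W *m B^T = block_mx (a *: cstruct1) 0 0 S :> 'M[R]_(2 + n.*2)].
Proof.
move=> compW; have a_gt0 := compatible_xy_gt0 ord0 compW.
case: compW => altW invW posW.
pose V : 'M[R]_(2 + n.*2) := W.
pose J : 'M[R]_(2 + n.*2) := @cstruct R n.+1.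
have altV : V^T = - V by exact: altW.
have invV : J *m V *m J^T = V by exact: invW.
have JE : J = block_mx cstruct1 0 0 cstruct by exact: cstruct_block.
set a := W _ _ in a_gt0.
pose W21 := dlsubmx V; pose W22 := drsubmx V.
have W12E : ursubmx V = - W21^T.
  by rewrite /W21 trmx_dlsub altV; apply/matrixP => i k; rewrite !mxE opprK.
have W11E : ulsubmx V = a *: cstruct1.
  rewrite [LHS]alternating_mx2; last first.
    by rewrite trmx_ulsub altV; apply/matrixP => i k; rewrite !mxE.
  congr (_ *: _); rewrite !mxE /V /a; congr (W _ _); exact: val_inj.
have VE : V = block_mx (a *: cstruct1) (- W21^T) W21 W22.
  by rewrite -[LHS]submxK W11E W12E.
(* The lower left block of the invariance of [V]; it will make [C] intertwine the complex
   structures. *)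
have J21 : cstruct *m W21 *m cstruct1 = - W21.
  have := invV; rewrite JE VE tr_block_mx !mulmx_block.
  rewrite !trmx0 !mul0mx !mulmx0 !add0r !addr0 => /eq_block_mx [_ _ + _].
  by rewrite tr_cstruct1 mulmxN => /(congr1 -%R); rewrite opprK.
have CJ : W21 *m cstruct1 *m cstruct1 = cstruct *m (W21 *m cstruct1).
  by rewrite -mulmxA cstruct1_sqr mulmxN mulmx1 mulmxA J21.
have a_neq0 : a != 0 by rewrite gt_eqF.
(* Chosen so that [C *m (a *: cstruct1) = - W21], as [cstruct1] squares to -1: [B] then clears the
   off-diagonal blocks. *)
pose C := a^-1 *: (W21 *m cstruct1).
pose B : 'M[R]_(2 + n.*2) := block_mx 1%:M 0 C 1%:M.
(* This commutation carries invariance and positivity over to [B *m V *m B^T]. *)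
have BJ : B *m J = J *m B.
  rewrite JE !mulmx_block !mul0mx !mulmx0 !mulmx1 !mul1mx !addr0 !add0r.
  by rewrite /C -scalemxAl CJ scalemxAr.
pose S := C *m (- W21^T) + W22.
have BVB : B *m V *m B^T = block_mx (a *: cstruct1) 0 0 S.
  rewrite VE tr_block_mx !mulmx_block !trmx1 !trmx0 !mul0mx !mulmx0 !mulmx1.
  rewrite !mul1mx !addr0.
  have -> : C *m (a *: cstruct1) + W21 = 0.
    rewrite -scalemxAr -scalemxAl scalerA divff // scale1r -mulmxA cstruct1_sqr.
    by rewrite mulmxN mulmx1 addNr.
  rewrite mul0mx add0r /C.
  have -> : a *: cstruct1 *m (a^-1 *: (W21 *m cstruct1))^T - W21^T = 0.
    rewrite linearZ /= trmx_mul tr_cstruct1 -scalemxAr -scalemxAl scalerA.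
    by rewrite mulVf // scale1r mulNmx mulmxN mulmxA cstruct1_sqr mulNmx mul1mx
      opprK subrr.
  by [].
have detB : \det B = 1 by rewrite det_lblock !det1 mulr1.
exists B, a, S; split => //.
have altB : (B *m V *m B^T)^T = - (B *m V *m B^T).
  by rewrite !trmx_mul trmxK altV mulNmx mulmxN mulmxA.
split.
- move: altB; rewrite BVB tr_block_mx opp_block_mx.
  by move/eq_block_mx => [].
- have : J *m (B *m V *m B^T) *m J^T = B *m V *m B^T.
    rewrite !mulmxA -BJ -!mulmxA -trmx_mul -BJ trmx_mul !mulmxA.
    congr (_ *m _); rewrite -!mulmxA; congr (_ *m _); rewrite !mulmxA.
    exact: invV.
  rewrite BVB JE tr_block_mx !mulmx_block.
  rewrite !trmx0 !mul0mx !mulmx0 !add0r !addr0.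
  by move/eq_block_mx => [].
(* Positivity of [S] at [v] is that of [V] at [u *m B], where [u] is [v] padded with zeros. *)
move=> v v_neq0; pose u : 'rV[R]_(2 + n.*2) := row_mx 0 v.
have uB_neq0 : u *m B != 0.
  rewrite /u mul_row_block !mul0mx !add0r mulmx1.
  by apply: contra_neq v_neq0 => /(congr1 rsubmx); rewrite row_mxKr linear0.
have : 0 < (u *m B *m V *m (u *m B *m J)^T) 0 0 by exact: posW.
rewrite -[_ *m B *m J]mulmxA BJ mulmxA [(_ *m B)^T]trmx_mul !mulmxA.
rewrite -[u *m B *m V]mulmxA -[u *m _ *m B^T]mulmxA BVB.
rewrite JE /u !mul_row_block.
by rewrite !mul0mx !mulmx0 !add0r tr_row_mx mul_row_col mul0mx add0r.
Qed.

(** Induction on [n]: one Schur complement splits off the first pair, and the congruence found for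
    the complement is extended by the identity on that pair. *)
Lemma compatible_pair_diag n (W : 'M[R]_n.*2) : compatible W ->
  exists A : 'M[R]_n.*2, [/\ \det A = 1, pair_diag (A *m W *m A^T) &
    forall j, 0 < (A *m W *m A^T) (xidx j) (yidx j)].
Proof.
elim: n W => [|n IHn] W compW.
  exists 1%:M; split; first exact: det1; last by case.
  by move=> i; case: (pair_of i).
have [B [a [S [detB a_gt0 compS BWB]]]] := compatible_schur compW.
have [A' [detA' diagA' A'_gt0]] := IHn S compS.
pose E : 'M[R]_(2 + n.*2) := block_mx 1%:M 0 0 A'.
have detE : \det E = 1 by rewrite det_lblock det1 mul1r.
pose D := A' *m S *m A'^T.
have EWE : E *m (block_mx (a *: cstruct1) 0 0 S) *m E^T =
    block_mx (a *: cstruct1) 0 0 D.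
  rewrite tr_block_mx !mulmx_block !trmx1 !trmx0 !mul0mx !mulmx0 !mulmx1.
  by rewrite !(mul1mx, mul0mx, addr0, add0r).
exists ((E : 'M[R]_(n.+1.*2)) *m B).
have -> : (E : 'M[R]_(n.+1.*2)) *m B *m W *m (E *m B)^T =
    block_mx (a *: cstruct1) 0 0 D :> 'M[R]_(2 + n.*2).
  by rewrite trmx_mul -EWE -BWB !mulmxA.
split; first by rewrite det_mulmx detE detB mulr1.
- move=> p q.
  have [i ->|i ->] := @split_ordP 2 n.*2 p; have [k ->|k ->] := @split_ordP 2 n.*2 q.
  + by rewrite !pair_lshift eqxx.
  + by move=> _; apply: (etrans (block_mxEur _ _ _ _ i k)); rewrite mxE.
  + by move=> _; apply: (etrans (block_mxEdl _ _ _ _ i k)); rewrite mxE.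
  + rewrite !pair_rshift (inj_eq lift_inj) => /diagA' D0.
    by apply: (etrans (block_mxEdr _ _ _ _ i k)).
move=> j; have [k ->|->] := unliftP ord0 j.
  have -> : xidx (lift ord0 k) = rshift 2 (xidx k) by exact: val_inj.
  have -> : yidx (lift ord0 k) = rshift 2 (yidx k) by exact: val_inj.
  have := A'_gt0 k; rewrite -/D.
  by rewrite -(block_mxEdr (a *: cstruct1) 0 0 D (xidx k) (yidx k)).
have -> : xidx ord0 = lshift n.*2 (0 : 'I_2) by exact: val_inj.
have -> : yidx ord0 = lshift n.*2 (1 : 'I_2) by exact: val_inj.
have : 0 < (a *: cstruct1) 0 1 by rewrite !mxE /= subr0 mulr1.
by rewrite -(block_mxEul (a *: cstruct1) 0 0 D 0 1).
Qed.

Lemma top_coef_gt0 n (W : 'M[R]_n.*2) : compatible W -> 0 < top_coef W.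
Proof.
move=> compW; have [A [detA diagA A_gt0]] := compatible_pair_diag compW.
have [altW _ _] := compW.
rewrite /top_coef mulr_gt0 ?invr_gt0 ?ltr0n ?muln_gt0 ?expn_gt0 ?fact_gt0 //.
suff : 0 < pfaff W by [].
rewrite -[pfaff W]mul1r -[X in X * _]detA -pfaff_congruence.
apply: pfaff_pair_diag_gt0 => //.
by rewrite !trmx_mul trmxK altW mulNmx mulmxN mulmxA.
Qed.

End Pfaffian.

(** * Integration over R^m *)

Section IntegralRV.
Set Implicit Arguments.
Unset Strict Implicit.
Context {R : realType}.

Lemma coord_norm_le m (x : 'rV[R]_m) i : `|x 0 i| <= `|x|.
Proof.
by rewrite [leRHS]/Num.Def.normr /= mx_normrE; apply/bigmax_geP; right; exists (0, i).
Qed.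

Lemma rV_norm_le m (x : 'rV[R]_m) (c : R) :
  0 <= c -> (forall i, `|x 0 i| <= c) -> `|x| <= c.
Proof.
move=> c_ge0 xc; rewrite [leLHS]/Num.Def.normr /= mx_normrE.
by apply/bigmax_leP; split => // -[i j] _ /=; rewrite ord1.
Qed.

Notation cons_rV s y := (row_mx (s%:M : 'rV[R]_1) y).

Lemma cons_rV0 m s (y : 'rV[R]_m) : (cons_rV s y) 0 (lshift m 0) = s.
Proof. by rewrite row_mxEl mxE. Qed.

Lemma norm_cons_rV_head m s (y : 'rV[R]_m) : `|s| <= `|cons_rV s y|.
Proof. by have := coord_norm_le (cons_rV s y) (lshift m 0); rewrite cons_rV0. Qed.

Lemma norm_cons_rV_tail m s (y : 'rV[R]_m) : `|y| <= `|cons_rV s y|.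
Proof.
apply: rV_norm_le => // i.
by have := coord_norm_le (cons_rV s y) (rshift 1 i); rewrite row_mxEr.
Qed.

Lemma norm_sub_cons_rV m s s' (y y' : 'rV[R]_m) (c : R) :
  `|s - s'| <= c -> `|y - y'| <= c -> `|cons_rV s y - cons_rV s' y'| <= c.
Proof.
move=> sc yc; apply: rV_norm_le => [|i]; first exact: le_trans (normr_ge0 _) sc.
have [k ->|k ->] := split_ordP i; rewrite mxE [X in _ + X]mxE.
  by rewrite !row_mxEl !mxE ord1.
by rewrite !row_mxEr; apply: le_trans yc; have := coord_norm_le (y - y') k; rewrite !mxE.
Qed.

(* Unlike continuity, uniform continuity passes to integrals of sections. *)
Definition ucont_supp (V : normedModType R) (r : R) (f : V -> R) : Prop :=
  (forall e, 0 < e -> exists2 d, 0 < d &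
     forall x y, `|x - y| < d -> `|f x - f y| < e) /\
  (forall x, r < `|x| -> f x = 0).

Lemma ucont_supp_lin (V : normedModType R) r (a : R) (f g : V -> R) :
  ucont_supp r f -> ucont_supp r g -> ucont_supp r (fun x => a * f x + g x).
Proof.
move=> [ucf f0] [ucg g0]; split=> [e e_gt0|x rx]; last first.
  by rewrite f0 // g0 // mulr0 addr0.
(* The summand 1 keeps the divisor below positive when [a] is 0. *)
have a1_gt0 : 0 < `|a| + 1 by rewrite ltr_wpDl.
have [d1 d1_gt0 fd] := ucf (e / 2 / (`|a| + 1)) ltac:(by rewrite !divr_gt0).
have [d2 d2_gt0 gd] := ucg (e / 2) ltac:(by rewrite divr_gt0).
exists (Num.min d1 d2) => [|x y]; first by rewrite lt_min d1_gt0.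
rewrite lt_min => /andP [xy1 xy2].
have -> : a * f x + g x - (a * f y + g y) = a * (f x - f y) + (g x - g y) by ring.
rewrite (le_lt_trans (ler_normD _ _)) // [e]splitr ler_ltD ?gd // normrM.
have := ltW (fd x y xy1); rewrite ler_pdivlMr // => le_f.
apply: le_trans le_f; rewrite mulrC ler_wpM2l // lerDl //.
Qed.

(** Heine-Cantor on a closed ball slightly larger than the support. *)
Lemma ucont_supp_continuous m r (f : 'rV[R]_m -> R) :
  continuous f -> (forall x, r < `|x| -> f x = 0) -> ucont_supp r f.
Proof.
move=> cf f0; split=> // e e_gt0.
(* With radius r + 1, a point outside [K] and all points at distance less than 1 from it lie where
   [f] vanishes. *)
pose K := [set x : 'rV[R]_m | `|x| <= r + 1].
have compK : compact K.
  apply: bounded_closed_compact.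
    by exists (r + 1); split; rewrite ?num_real // => M rM x /= /le_trans; apply; apply: ltW.
  apply: (@preimage_closed _ _ (fun x : 'rV[R]_m => `|x|) [set s | s <= r + 1]).
    by move=> x _; exact: norm_continuous.
  exact: closed_le.
pose P d x := forall y, `|x - y| < d -> `|f x - f y| < e.
(* One [d] for all of [K], by compactness in its near-covering form. *)
suff : \forall d \near 0^'+, K `<=` P d.
  move=> /(filterI (nbhs_right_gt 0)) /filter_ex [d [/= d_gt0 fd]].
  exists (Num.min d 1) => [|x y]; first by rewrite lt_min d_gt0 /=.
  rewrite lt_min => /andP [xyd xy1].
  have [xr|xr] := leP `|x| (r + 1); first exact: fd.
  rewrite (f0 x) ?(f0 y) ?subrr ?normr0 //; last by apply: lt_trans xr; rewrite ltrDl.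
  have : `|x| <= `|x - y| + `|y| by rewrite -{1}(subrK y x) ler_normD.
  by lra.
apply: (compact_near_coveringP K).1 => //.
move=> x _; have /cvgrPdist_lt/(_ (e / 2)) := cf x.
  rewrite divr_gt0 // => /(_ isT) /nbhs_ballP [h /= h_gt0 fh].
  exists (ball x (h / 2), [set d | d < h / 2]).
    split => /=; first exact/nbhsx_ballx/divr_gt0.
    by apply: nbhs_right_lt; rewrite divr_gt0.
  move=> [x' d] /= [xx' dh] y x'y.
  have fx' : `|f x - f x'| < e / 2.
    by apply: fh; apply: le_ball xx'; rewrite ler_piMr ?ltW // invf_lt1 // ltr1n.
  have fy : `|f x - f y| < e / 2.
    apply: fh; rewrite -ball_normE /= [h]splitr.
    have -> : x - y = (x - x') + (x' - y) by rewrite addrA subrK.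
    rewrite (le_lt_trans (ler_normD _ _)) // ltrD //.
      by move: xx'; rewrite -ball_normE.
    exact: lt_trans dh.
  have -> : f x' - f y = (f x - f y) - (f x - f x') by ring.
  by rewrite (le_lt_trans (ler_normB _ _)) // [e]splitr ltrD.
Qed.

(** * Integrals over the line *)

Notation mu := (@lebesgue_measure R).

Lemma ucont_supp_cts r (F : R -> R) : ucont_supp r F -> continuous F.
Proof.
move=> [ucF _] x; apply/cvgrPdist_lt => e /ucF [d d_gt0 Fd].
near=> y; apply: Fd; near: y.
by apply/nbhs_ballP; exists d => //= y; rewrite -ball_normE.
Unshelve. all: by end_near. Qed.

Lemma ucont_supp_restrict r (F : R -> R) :
  ucont_supp r F -> F \_ `[- r, r] = F.
Proof.
move=> [_ F0]; apply/funext => x; rewrite patchE; case: ifPn => //.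
rewrite notin_setE /= in_itv /= -ler_norml => /negP.
by rewrite -ltNge => /F0.
Qed.

Lemma ucont_supp_integrable r (F : R -> R) :
  ucont_supp r F -> mu.-integrable [set: R] (EFin \o F).
Proof.
move=> ucF; rewrite -(ucont_supp_restrict ucF) -restrict_EFin.
apply/(integrable_mkcond _ _).1 => //.
apply: continuous_compact_integrable; first exact: segment_compact.
by apply: continuous_subspaceT; exact: ucont_supp_cts ucF.
Qed.

Lemma measure_segment (a b : R) : a <= b ->
  lebesgue_measure (`[a, b] : set R) = (b - a)%:E.
Proof.
rewrite le_eqVlt => /predU1P[->|ab].
  by rewrite lebesgue_measure_itv /= lte_fin ltxx subrr.
by rewrite lebesgue_measure_itv /= lte_fin ab.
Qed.

Lemma integrable_cst_segment (a b c : R) :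
  mu.-integrable `[a, b] (EFin \o cst c).
Proof.
apply: continuous_compact_integrable; first exact: segment_compact.
by apply: continuous_subspaceT => x; exact: cvg_cst.
Qed.

Lemma Rintegral_cst_segment (a b c : R) : a <= b ->
  \int[mu]_(x in `[a, b]) c = c * (b - a).
Proof.
move=> ab; rewrite Rintegral_cst //; congr (_ * _).
by transitivity (fine (b - a)%:E) => //; congr fine; exact: measure_segment.
Qed.

Lemma ucont_supp_Rintegral_bound r (F : R -> R) c : 0 <= r ->
  ucont_supp r F -> (forall x, `|F x| <= c) ->
  `|\int[mu]_(x in [set: R]) F x| <= c * (2 * r).
Proof.
move=> r_ge0 ucF Fc.
have -> : \int[mu]_(x in [set: R]) F x = \int[mu]_(x in `[- r, r]) F x.
  by rewrite [RHS]Rintegral_mkcond (ucont_supp_restrict ucF).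
have intF : mu.-integrable `[- r, r] (EFin \o F).
  by apply: integrableS (ucont_supp_integrable ucF).
rewrite (le_trans (le_normr_Rintegral _ intF)) //.
have -> : c * (2 * r) = \int[mu]_(x in `[- r, r]) c.
  by rewrite Rintegral_cst_segment ?opprK; [ring | lra].
apply: le_Rintegral => //; first exact: integrable_norm.
exact: integrable_cst_segment.
Qed.

(** By uniform continuity [F] exceeds half of [F x0] on a segment around [x0], which bounds the
    integral from below. *)
Lemma ucont_supp_Rintegral_gt0 r (F : R -> R) x0 :
  ucont_supp r F -> (forall x, 0 <= F x) -> 0 < F x0 ->
  0 < \int[mu]_(x in [set: R]) F x.
Proof.
move=> ucF F_ge0 F_gt0; have [d d_gt0 Fd] := ucF.1 (F x0 / 2) ltac:(by rewrite divr_gt0).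
pose J := `[x0 - d / 2, x0 + d / 2]%classic.
have mJ : measurable J by exact: measurable_itv.
have intJ : mu.-integrable J (EFin \o cst (F x0 / 2)).
  exact: integrable_cst_segment.
have : \int[mu]_(x in J) (F x0 / 2) <= \int[mu]_(x in [set: R]) F x.
  rewrite Rintegral_mkcond; apply: le_Rintegral => //.
  - by rewrite -restrict_EFin; apply/(integrable_mkcond _ _).1.
  - exact: ucont_supp_integrable ucF.
  move=> x _; rewrite patchE; case: ifPn => // /set_mem.
  rewrite /J /= in_itv /= => xJ.
  have /Fd : `|x0 - x| < d by rewrite ltr_norml; lra.
  by rewrite ltr_norml; lra.
apply: lt_le_trans; rewrite Rintegral_cst_segment; last by lra.
by rewrite mulr_gt0 ?divr_gt0 //; lra.
Qed.

(** * Iterated integrals *)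

Lemma ucont_supp_section m r (f : 'rV[R]_m.+1 -> R) s :
  ucont_supp r f -> ucont_supp r (fun y : 'rV[R]_m => f (cons_rV s y)).
Proof.
move=> [ucf f0]; split=> [e /ucf [d d_gt0 fd]|y ry].
  (* Half of [d], because [norm_sub_cons_rV] gives a weak inequality only. *)
  exists (d / 2) => [|x y xy]; first by rewrite divr_gt0.
  apply: fd; apply: le_lt_trans (_ : d / 2 < d); last by lra.
  by apply: norm_sub_cons_rV; rewrite ?subrr ?normr0 ltW // divr_gt0.
by rewrite f0 // (lt_le_trans ry) // norm_cons_rV_tail.
Qed.

Lemma integral_rV_ge0 m (f : 'rV[R]_m -> R) :
  (forall x, 0 <= f x) -> 0 <= integral_rV f.
Proof.
elim: m f => [|m IHm] f f_ge0 /=; first exact: f_ge0.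
by apply: Rintegral_ge0 => s _; apply: IHm.
Qed.

(** By linearity, the integrals of two nearby sections differ by the integral of a uniformly small
    function, which the bound controls. Linearity and the bound in dimension [m] are hypotheses here
    because their own induction uses this lemma. *)
Lemma ucont_supp_integral_section m r (f : 'rV[R]_m.+1 -> R) :
  (forall g h : 'rV[R]_m -> R, ucont_supp r g -> ucont_supp r h ->
     forall a, integral_rV (fun x => a * g x + h x) =
               a * integral_rV g + integral_rV h) ->
  (forall (g : 'rV[R]_m -> R) c, ucont_supp r g -> (forall x, `|g x| <= c) ->
     `|integral_rV g| <= c * (2 * r) ^+ m) ->
  0 <= r -> ucont_supp r f ->
  ucont_supp r (fun s => integral_rV (fun y : 'rV[R]_m => f (cons_rV s y))).
Proof.
move=> lin bound r_ge0 ucf; have [ucf' f0] := ucf.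
split=> [e e_gt0|s rs]; last first.
  apply/eqP; rewrite -normr_le0 -(mul0r ((2 * r) ^+ m)).
  apply: bound => [|y]; first exact: ucont_supp_section.
  by rewrite f0 ?normr0 // (lt_le_trans rs) // norm_cons_rV_head.
have r_gt0 : 0 < (2 * r) ^+ m + 1 by rewrite ltr_wpDl // exprn_ge0 // mulr_ge0.
have [d d_gt0 fd] := ucf' (e / ((2 * r) ^+ m + 1)) ltac:(by rewrite divr_gt0).
exists (d / 2) => [|s s' ss']; first by rewrite divr_gt0.
pose I t := integral_rV (fun y : 'rV[R]_m => f (cons_rV t y)).
rewrite distrC -/(I s) -/(I s').
have -> : I s' - I s =
    integral_rV (fun y : 'rV[R]_m => -1 * f (cons_rV s y) + f (cons_rV s' y)).
  by rewrite lin; [rewrite /I; ring | exact: ucont_supp_section..].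
apply: le_lt_trans (bound _ (e / ((2 * r) ^+ m + 1)) _ _) _.
- by apply: ucont_supp_lin; exact: ucont_supp_section.
- move=> y; apply: ltW; rewrite mulN1r addrC; apply: fd.
  rewrite distrC; apply: le_lt_trans (_ : d / 2 < d); last by lra.
  by apply: norm_sub_cons_rV; [exact: ltW|rewrite subrr normr0 ltW // divr_gt0].
by rewrite mulrAC ltr_pdivrMr // ltr_pM2l // ltrDl.
Qed.

(** Both properties go through a single induction: in dimension m + 1 each needs the inner integral
    to be integrable, which rests on both in dimension m. *)
Lemma integral_rV_lin_bound m r : 0 <= r ->
  (forall g h : 'rV[R]_m -> R, ucont_supp r g -> ucont_supp r h ->
     forall a, integral_rV (fun x => a * g x + h x) =
               a * integral_rV g + integral_rV h) /\
  (forall (g : 'rV[R]_m -> R) c, ucont_supp r g -> (forall x, `|g x| <= c) ->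
     `|integral_rV g| <= c * (2 * r) ^+ m).
Proof.
move=> r_ge0; elim: m => [|m [lin bound]].
  by split=> [//|g c _ gc]; rewrite expr0 mulr1; exact: gc.
have ucI f := @ucont_supp_integral_section m r f lin bound r_ge0.
split=> [g h ucg uch a|g c ucg gc] /=.
  have intg := ucont_supp_integrable (ucI _ ucg).
  have inth := ucont_supp_integrable (ucI _ uch).
  rewrite -RintegralZl // -RintegralD //; last first.
    pose G s := integral_rV (fun y : 'rV[R]_m => g (cons_rV s y)).
    rewrite (_ : EFin \o _ = (fun s => a%:E * (EFin \o G) s)%E) //.
    exact: integrableZl.
  apply: eq_Rintegral => s _.
  by rewrite lin //; exact: ucont_supp_section.
rewrite exprSr mulrA; apply: (ucont_supp_Rintegral_bound r_ge0 (ucI _ ucg)) => s.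
by apply: bound => //; exact: ucont_supp_section.
Qed.

Lemma integral_rV_lin m r (a : R) (g h : 'rV[R]_m -> R) : 0 <= r ->
  ucont_supp r g -> ucont_supp r h ->
  integral_rV (fun x => a * g x + h x) = a * integral_rV g + integral_rV h.
Proof. by move=> r_ge0 ucg uch; apply: (integral_rV_lin_bound m r_ge0).1. Qed.

(** By induction the inner integral is positive at the first coordinate of [x0]; it is also
    continuous and nonnegative. *)
Lemma integral_rV_gt0 m r (f : 'rV[R]_m -> R) x0 : 0 <= r ->
  ucont_supp r f -> (forall x, 0 <= f x) -> 0 < f x0 -> 0 < integral_rV f.
Proof.
move=> r_ge0; elim: m f x0 => [|m IHm] f x0 ucf f_ge0 f_gt0 /=.
  by rewrite (_ : 0 = x0) //; apply/rowP => -[].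
have [lin bound] := integral_rV_lin_bound m r_ge0.
have ucI := @ucont_supp_integral_section m r f lin bound r_ge0 ucf.
apply: (@ucont_supp_Rintegral_gt0 r _ (x0 0 0) ucI) => [s|].
  exact: integral_rV_ge0.
apply: (IHm _ (rsubmx (x0 : 'rV[R]_(1 + m)))) => //.
  exact: ucont_supp_section.
rewrite (_ : cons_rV _ _ = x0) //.
by rewrite -[RHS](hsubmxK (x0 : 'rV[R]_(1 + m))); congr row_mx;
  apply/rowP => i; rewrite ord1 !mxE; congr (x0 _ _); apply: val_inj.
Qed.

End IntegralRV.

(** * Integration over the manifold *)

Section IntegralKform.
Set Implicit Arguments.
Unset Strict Implicit.
Context {R : realType} {n : nat} {M : closedKaehlerManifold R n}.

(** The regularity under which integrals are handled: it passes at once to sums, products and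
    exponentials. *)
Definition chart_cts (f : M -> R) : Prop :=
  forall (i : chart_idx M) x, chart_img i x ->
    {for x, continuous (f \o chart_inv i)}.

Lemma smooth_chart_cts (f : M -> R) : smooth f -> chart_cts f.
Proof. by move=> sf i x ix; have [cf _] := sf i 0; exact: cf. Qed.

Lemma kform_compatible (i : chart_idx M) x :
  chart_img i x -> compatible (kform i x).
Proof.
move=> ix; have kP := kformP M; split.
- exact: (kform_alternating kP).
- exact: (kform_invariant kP).
- exact: (kform_positive kP).
Qed.

Lemma top_coef_cts (i : chart_idx M) x : chart_img i x ->
  {for x, continuous (fun y => top_coef (kform i y))}.
Proof.
move=> ix; have ck a b : {for x, continuous (fun y => kform i y a b)}.
  by have [cf _] := kform_smooth (kformP M) i a b 0; exact: cf.
apply: continuousM; first exact: cst_continuous.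
rewrite /continuous_at; apply: cvg_big => [||s _].
- exact: add_continuous.
- exact: nbhs_filter.
suff : {for x, continuous (fun y => (-1) ^+ s *
    \prod_(j < n) kform i y (s (xidx j)) (s (yidx j)))} by [].
apply: continuousM; first exact: cst_continuous.
rewrite /continuous_at; apply: cvg_big => [||j _].
- exact: mul_continuous.
- exact: nbhs_filter.
exact: ck.
Qed.

Variable P : @partition_of_unity R n M.

Definition pou_integrand (k : 'I_(pou_size P)) (f : M -> R) :=
  (fun x => let p := chart_inv (pou_idx k) x in
            pou_fun k p * f p * top_coef (kform (pou_idx k) x))
     \_ (chart_img (pou_idx k)).

Lemma integral_kformE f : integral_kform P f = \sum_k integral_rV (pou_integrand k f).
Proof. by []. Qed.

(** The support of the partition function is compact, so its image [K] in the chart is compact and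
    closed. The integrand is continuous on the open chart image and 0 on the open complement of [K],
    and these two sets cover the space. The radius is the same for all [f], as linearity
    requires. *)
Lemma pou_integrand_ucont k : exists2 r, 0 <= r &
  forall f, chart_cts f -> ucont_supp r (pou_integrand k f).
Proof.
set i := pou_idx k.
pose S := closure [set p | pou_fun k p != 0].
have Sdom : S `<=` chart_dom i := @pou_supp _ _ _ P k.
have compS : compact S.
  by apply: subclosed_compact (@closed_closure _ _) (@carrier_compact _ _ M) _.
pose K := chart i @` S.
have compK : compact K.
  apply: continuous_compact => //; apply: continuous_in_subspaceT => p.
  by move=> /set_mem /Sdom; exact: chart_continuous.
have [B [_ KB]] := compact_bounded compK.
(* Every number above [B] bounds [K]; [|B| + 1] is one that is also nonnegative. *)
have K_le x : K x -> `|x| <= `|B| + 1.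
  by apply: KB; rewrite ltr_pwDr // ler_norm.
have pou0 x : chart_img i x -> ~ K x -> pou_fun k (chart_inv i x) = 0.
  move=> [p ip <-] nK; rewrite chartK //; apply/eqP/negPn/negP => pou_neq0.
  by apply: nK; exists p => //; exact: subset_closure.
have integrand0 f x : ~ K x -> pou_integrand k f x = 0.
  move=> nK; rewrite /pou_integrand patchE; case: ifPn => // /set_mem ix.
  by rewrite /= pou0 // !mul0r.
exists (`|B| + 1) => [|f cf]; first by rewrite addr_ge0.
apply: ucont_supp_continuous => [x|x Bx]; last first.
  by apply: integrand0 => /K_le; rewrite leNgt Bx.
have [ix|nix] := pselect (chart_img i x).
  pose g x := pou_fun k (chart_inv i x) * f (chart_inv i x) * top_coef (kform i x).
  have cg : {for x, continuous g}.
    apply: continuousM; last exact: top_coef_cts.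
    apply: continuousM; last exact: cf.
    exact: (smooth_chart_cts (pou_smooth k)).
  have : \forall y \near x, g y = pou_integrand k f y.
    have := open_nbhs_nbhs (conj (@chart_img_open _ _ M i) ix); apply: filterS => y iy.
    by rewrite /pou_integrand patchE mem_set.
  move=> gE; have gxE := nbhs_singleton gE.
  rewrite /continuous_at -gxE; move=> U /cg.
  by apply: (@filterS2 _ _ (nbhs_filter x) _ _ _ _ gE) => y /= <-.
have nK : ~ K x by move=> [p Sp px]; apply: nix; exists p => //; exact: Sdom.
have clK : closed K by apply: compact_closed => //; exact: norm_hausdorff.
have nearK := open_nbhs_nbhs (conj (closed_openC clK) nK).
rewrite /continuous_at integrand0 // => U /nbhs_singleton U0.
by apply: (@filterS _ _ (nbhs_filter x) _ _ _ nearK) => y /integrand0 /= ->.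
Qed.

Lemma integral_kform_lin (a : R) (f g : M -> R) : chart_cts f -> chart_cts g ->
  integral_kform P (fun p => a * f p + g p) =
  a * integral_kform P f + integral_kform P g.
Proof.
move=> cf cg; rewrite !integral_kformE mulr_sumr -big_split /=; apply: eq_bigr => k _.
have [r r_ge0 ucr] := pou_integrand_ucont k.
rewrite -(integral_rV_lin a r_ge0 (ucr f cf) (ucr g cg)); congr integral_rV.
apply/funext => x; rewrite /pou_integrand !patchE; case: ifPn => _ /=;
  last by rewrite mulr0 addr0.
by set q := top_coef _; ring.
Qed.

Lemma top_coef_kform_gt0 (i : chart_idx M) x :
  chart_img i x -> 0 < top_coef (kform i x).
Proof. by move=> ix; apply: top_coef_gt0; exact: kform_compatible. Qed.

Lemma pou_integrand_ge0 k f x : (forall p, 0 <= f p) -> 0 <= pou_integrand k f x.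
Proof.
move=> f_ge0; rewrite /pou_integrand patchE; case: ifPn => // /set_mem ix.
apply: mulr_ge0; last exact/ltW/top_coef_kform_gt0.
by apply: mulr_ge0; [exact: pou_ge0 | exact: f_ge0].
Qed.

Lemma integral_kform_ge0 f : (forall p, 0 <= f p) -> 0 <= integral_kform P f.
Proof.
move=> f_ge0; rewrite integral_kformE; apply: sumr_ge0 => k _.
by apply: integral_rV_ge0 => x; exact: pou_integrand_ge0.
Qed.

(** The partition functions sum to 1 at [p], so one of them is positive there and its chart
    contributes a positive integral. *)
Lemma integral_kform_gt0 f p : chart_cts f -> (forall p, 0 <= f p) -> 0 < f p ->
  0 < integral_kform P f.
Proof.
move=> cf f_ge0 f_gt0; rewrite integral_kformE.
have [k pou_gt0] : exists k : 'I_(pou_size P), 0 < pou_fun k p.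
  apply: contrapT => /forallNP pou_le0; have := pou_sum1 P p.
  rewrite big1 => [/esym/eqP|k _].
    by rewrite oner_eq0.
  by apply/eqP; rewrite eq_le pou_ge0 leNgt andbT; apply/negP.
rewrite (bigD1 k) //=; apply: ltr_wpDr.
  by apply: sumr_ge0 => l _; apply: integral_rV_ge0 => x; exact: pou_integrand_ge0.
have [r r_ge0 ucr] := pou_integrand_ucont k.
have ip : chart_dom (pou_idx k) p.
  by apply: (@pou_supp _ _ _ P k); apply: subset_closure; rewrite /= gt_eqF.
apply: (integral_rV_gt0 (x0 := chart (pou_idx k) p) r_ge0 (ucr f cf)).
  by move=> x; exact: pou_integrand_ge0.
have ix : chart_img (pou_idx k) (chart (pou_idx k) p) by exists p.
rewrite /pou_integrand patchE mem_set //= chartK //.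
apply: mulr_gt0; last exact: top_coef_kform_gt0.
exact: mulr_gt0.
Qed.

Lemma Vol_gt0 : 0 < Vol P.
Proof.
have [p _] := carrier_neq0 M.
by apply: (@integral_kform_gt0 _ p) => // i x _; exact: cst_continuous.
Qed.

End IntegralKform.

(** * Derivatives in time *)

Section RealDerivatives.
Set Implicit Arguments.
Unset Strict Implicit.
Context {R : realType}.
Implicit Types (f g : R -> R) (I : set R) (t a b c : R).

Lemma deriv_add f g t a b : is_derive t 1 f a -> is_derive t 1 g b ->
  is_derive t 1 (fun s => f s + g s) (a + b).
Proof. exact: is_deriveD. Qed.

Lemma deriv_mul f g t a b : is_derive t 1 f a -> is_derive t 1 g b ->
  is_derive t 1 (fun s => f s * g s) (a * g t + f t * b).
Proof.
move=> fa gb; apply: is_derive_eq (is_deriveM fa gb) _.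
by rewrite /GRing.scale /=; ring.
Qed.

Lemma deriv_scale f t a c : is_derive t 1 f a ->
  is_derive t 1 (fun s => c * f s) (c * a).
Proof. exact: is_deriveZ. Qed.

Lemma deriv_expR f t a : is_derive t 1 f a ->
  is_derive t 1 (fun s => expR (f s)) (expR (f t) * a).
Proof. by move=> fa; apply: is_derive1_comp. Qed.

Lemma deriv_comp_scale f c t a : is_derive (c * t) 1 f a ->
  is_derive t 1 (fun s => f (c * s)) (c * a).
Proof.
move=> fa; rewrite mulrC; apply: (@is_derive1_comp _ f (fun s => c * s)) => //.
by apply: is_derive_eq (deriv_scale c (is_derive_id t 1)) _; rewrite mulr1.
Qed.

(** Product rule for the symmetric bilinear form with coefficients [A], [B], [C], to which the
    integrals of w^2, w w' and w'^2 will reduce. *)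
Lemma deriv_quadratic (A B C : R) f f' g g' t a b a' b' :
  is_derive t 1 f a -> is_derive t 1 g b ->
  is_derive t 1 f' a' -> is_derive t 1 g' b' ->
  is_derive t 1
    (fun s => A * (f s * f' s) + B * (f s * g' s + g s * f' s) + C * (g s * g' s))
    (A * (a * f' t + f t * a') + B * (a * g' t + f t * b' + (b * f' t + g t * a'))
       + C * (b * g' t + g t * b')).
Proof.
move=> fa gb fa' gb'; apply: deriv_add; last exact/deriv_scale/deriv_mul.
apply: deriv_add; first exact/deriv_scale/deriv_mul.
by apply/deriv_scale/deriv_add; exact: deriv_mul.
Qed.

Lemma is_derive_uniq f t a b : is_derive t 1 f a -> is_derive t 1 f b -> a = b.
Proof. by move=> [_ <-] [_ <-]. Qed.

Lemma deriv_cst_on I f c t a : open I -> I t -> (forall s, I s -> f s = c) ->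
  is_derive t 1 f a -> a = 0.
Proof.
move=> oI It fc fa; apply: is_derive_uniq fa _.
apply: near_eq_is_derive (is_derive_cst c t 1).
by have := open_nbhs_nbhs (conj oI It); apply: filterS => s /fc ->.
Qed.

Lemma deriv0_cst I f s t : is_interval I ->
  (forall r, I r -> is_derive r 1 f 0) -> I s -> I t -> f s = f t.
Proof.
move=> itvI f0; wlog st : s t / s <= t.
  by move=> W Is It; have [/W|/ltW /W ->] := leP s t; [apply|..].
move=> Is It.
have sub r : r \in `[s, t] -> I r.
  by rewrite in_itv /= => /andP [sr rt]; apply: (itvI s t) => //; apply/andP.
have [||r _ /eqP] := @MVT_segment R f (fun=> 0) s t st _ _.
- by move=> r /subset_itv_oo_cc /sub /f0.
- apply: derivable_within_continuous => r /sub /f0 [].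
  by [].
by rewrite mul0r subr_eq0 => /eqP.
Qed.

End RealDerivatives.

Section TimeDerivative.
Set Implicit Arguments.
Unset Strict Implicit.
Context {R : realType} {n : nat} {M : closedKaehlerManifold R n}.
Implicit Types (I : set R) (u : R -> M -> R).

Local Notation space_time t x := (row_mx (t%:M : 'rV[R]_1) (x : 'rV[R]_n.*2)).

Definition chart_rep u (i : chart_idx M) (y : 'rV[R]_(1 + n.*2)) : R :=
  u (y 0 0) (chart_inv i (rsubmx y)).

Lemma time_coord t (x : 'rV[R]_n.*2) : (space_time t x) 0 0 = t.
Proof.
have -> : (0 : 'I_(1 + n.*2)) = lshift n.*2 0 by exact: val_inj.
by rewrite row_mxEl mxE.
Qed.

Lemma space_timeK (y : 'rV[R]_(1 + n.*2)) : space_time (y 0 0) (rsubmx y) = y.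
Proof.
rewrite -[RHS]hsubmxK; congr row_mx; apply/rowP => j.
by rewrite ord1 !mxE; congr (y _ _); exact: val_inj.
Qed.

Lemma chart_rep_space_time u i t x :
  chart_rep u i (space_time t x) = u t (chart_inv i x).
Proof. by rewrite /chart_rep time_coord row_mxKr. Qed.

Lemma along_time u i t x :
  along (chart_rep u i) 0 (space_time t x) = fun h => u (t + h) (chart_inv i x).
Proof.
apply/funext => h; rewrite /along -chart_rep_space_time; congr chart_rep.
apply/rowP => j; rewrite mxE [X in _ + X]mxE [X in h * X]mxE.
have [k ->|k ->] := split_ordP j.
  by rewrite !row_mxEl !mxE ord1 (_ : (lshift _ _ == _) = true) // mulr1.
by rewrite !row_mxEr (_ : (rshift 1 k == _) = false) // andbF mulr0 addr0.
Qed.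

Lemma derive_quotient_shift (g : R -> R) t :
  (fun h : R => h^-1 *: (((fun s => g (t + s)) \o shift 0) (h *: (1 : R)) - g (t + 0))) =
  (fun h : R => h^-1 *: ((g \o shift t) (h *: (1 : R)) - g t)).
Proof. by apply/funext => h; rewrite /= !addr0 [t + _]addrC. Qed.

Lemma derivable_shift (g : R -> R) t :
  derivable (fun s => g (t + s)) 0 1 -> derivable g t 1.
Proof. by rewrite /derivable derive_quotient_shift. Qed.

Lemma derive1_shift (g : R -> R) t : derive1 (fun s => g (t + s)) 0 = derive1 g t.
Proof. by rewrite !derive1E /derive derive_quotient_shift. Qed.

(** Both sides are limits of the same difference quotients. This makes [jointly_smooth] stable under
    [dt]. *)
Lemma partial_time u i : partial (chart_rep u i) 0 = chart_rep (dt u) i.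
Proof.
apply/funext => y; rewrite -(space_timeK y) /partial along_time.
by rewrite (derive1_shift (u ^~ _)) chart_rep_space_time.
Qed.

Lemma jointly_smooth_dt I u : jointly_smooth I u -> jointly_smooth I (dt u).
Proof.
move=> su i k; have [_ /(_ 0) [_]] := su i k.+1.
by rewrite partial_time.
Qed.

Lemma jointly_smooth_deriv I u t p : jointly_smooth I u -> I t ->
  is_derive t 1 (u ^~ p) (dt u t p).
Proof.
move=> su It; have [i ip] := chart_cover p.
have [_ /(_ 0) [+ _]] := su i 1%N.
move=> /(_ (space_time t (chart i p))).
rewrite along_time chartK // /= time_coord row_mxKr => d.
apply: DeriveDef; last by rewrite /dt derive1E.
by apply: derivable_shift; apply: d; split => //; exists p.
Qed.

Lemma jointly_smooth_chart_cts I u t :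
  jointly_smooth I u -> I t -> chart_cts (u t).
Proof.
move=> su It i x ix; have [/(_ (space_time t x)) + _] := su i 0%N.
rewrite /= time_coord row_mxKr => /(_ (conj It ix)) cu.
rewrite (_ : _ \o _ = chart_rep u i \o (fun z : 'rV[R]_n.*2 => space_time t z)); last first.
  by apply/funext => z; rewrite /= chart_rep_space_time.
apply: continuous_comp; last exact: cu.
move=> U /nbhs_ballP [e /= e_gt0 eU]; apply/nbhs_ballP.
exists (e / 2) => [|z xz]; first by rewrite /= divr_gt0.
apply: eU; move: xz; rewrite -!ball_normE /= => xz.
apply: le_lt_trans (_ : e / 2 < e); last by lra.
apply: norm_sub_cons_rV; first by rewrite subrr normr0 ltW // divr_gt0.
exact: ltW.
Qed.

End TimeDerivative.

(** * Geodesics *)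

Section Geodesics.
Set Implicit Arguments.
Unset Strict Implicit.
Context {R : realType} {n : nat} {M : closedKaehlerManifold R n}.
Implicit Types (I : set R) (u : R -> M -> R) (f g : M -> R).

Lemma chart_cts_cst (c : R) : chart_cts (fun _ : M => c).
Proof. by move=> i x _; exact: cst_continuous. Qed.
Arguments chart_cts_cst c : clear implicits.

Lemma chart_ctsD f g : chart_cts f -> chart_cts g -> chart_cts (fun p => f p + g p).
Proof. by move=> cf cg i x ix; apply: continuousD; [exact: cf | exact: cg]. Qed.

Lemma chart_ctsM f g : chart_cts f -> chart_cts g -> chart_cts (fun p => f p * g p).
Proof. by move=> cf cg i x ix; apply: continuousM; [exact: cf | exact: cg]. Qed.

Lemma chart_cts_expR f : chart_cts f -> chart_cts (fun p => expR (f p)).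
Proof.
move=> cf i x ix; apply: (@continuous_comp _ _ _ (f \o chart_inv i) expR).
  exact: cf.
exact: continuous_expR.
Qed.

Definition half_exp u t p : R := expR (u t p / 2).

(** Closed formulas for the first two time derivatives of w = e^(u/2), so that continuity in [p] can
    be read off. *)
Definition half_exp' u t p : R := dt u t p / 2 * half_exp u t p.

Definition half_exp'' u t p : R :=
  (dt (dt u) t p / 2 + dt u t p ^+ 2 / 4) * half_exp u t p.

Lemma half_exp_gt0 u t p : 0 < half_exp u t p.
Proof. exact: expR_gt0. Qed.

Lemma half_exp_sqr u t p : half_exp u t p ^+ 2 = expR (u t p).
Proof. by rewrite expr2 -expRD; congr expR; field. Qed.

Lemma half_exp_deriv I u t p : jointly_smooth I u -> I t ->
  is_derive t 1 (half_exp u ^~ p) (half_exp' u t p).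
Proof.
move=> su It; have du := jointly_smooth_deriv p su It.
have := deriv_expR (deriv_scale 2^-1 du).
rewrite (_ : (fun s => _) = half_exp u ^~ p); last first.
  by apply/funext => s; rewrite /half_exp mulrC.
move=> d; apply: is_derive_eq d _.
by rewrite /half_exp' /half_exp [2^-1 * u t p]mulrC; field.
Qed.

Lemma half_exp'_deriv I u t p : jointly_smooth I u -> I t ->
  is_derive t 1 (half_exp' u ^~ p) (half_exp'' u t p).
Proof.
move=> su It; have d1 := half_exp_deriv p su It.
have d2 := jointly_smooth_deriv p (jointly_smooth_dt su) It.
have := deriv_scale 2^-1 (deriv_mul d2 d1).
rewrite (_ : (fun s => _) = half_exp' u ^~ p); last first.
  by apply/funext => s; rewrite /half_exp'; field.
by move=> d; apply: is_derive_eq d _; rewrite /half_exp'' /half_exp'; field.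
Qed.

Lemma derive2_half_exp I u (c s : R) p : open I -> jointly_smooth I u -> I (c * s) ->
  derive1n 2 (fun r => expR (u (c * r) p / 2)) s = c ^+ 2 * half_exp'' u (c * s) p.
Proof.
move=> oI su Ics; rewrite derive1nS derive1n1 derive1E.
have cscale : {for s, continuous (fun r : R => c * r)}.
  by apply: continuousM; [exact: cst_continuous | exact: cvg_id].
have nearI : \forall r \near s, I (c * r).
  by apply: cscale; exact: open_nbhs_nbhs (conj oI Ics).
(* The formula for the first derivative holds where [c * r] is in [I], hence near [s], which
   determines the second derivative. *)
have -> : 'D_1 (derive1 (fun r => expR (u (c * r) p / 2))) s =
          'D_1 (fun r => c * half_exp' u (c * r) p) s.
  apply: near_eq_derive; apply: filterS nearI => r Icr; rewrite derive1E.
  by have [_ ->] := deriv_comp_scale (half_exp_deriv p su Icr).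
have [_ ->] := deriv_scale c (deriv_comp_scale (half_exp'_deriv p su Ics)).
by rewrite mulrA.
Qed.

Variable P : @partition_of_unity R n M.

Lemma integral_kformZ (a : R) f : chart_cts f ->
  integral_kform P (fun p => a * f p) = a * integral_kform P f.
Proof.
move=> cf; have := @integral_kform_lin _ _ _ P a f (fun=> 0) cf (chart_cts_cst 0).
(* Linearity with coefficient -1 shows that the integral of 0 is 0. *)
have -> : integral_kform P (fun=> 0) = 0.
  have := @integral_kform_lin _ _ _ P (-1) _ _ (chart_cts_cst 0) (chart_cts_cst 0).
  rewrite (_ : (fun p => _) = fun=> 0); last by apply/funext => p; rewrite mulr0 addr0.
  by move=> ->; ring.
rewrite addr0 => <-; congr integral_kform.
by apply/funext => p; rewrite addr0.
Qed.

(** The terms keep the unsimplified shape of [deriv_quadratic]. *)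
Lemma integral_kform_quadratic f g (s r : R) : chart_cts f -> chart_cts g ->
  integral_kform P (fun p => (f p * s + g p * r) ^+ 2) =
  integral_kform P (fun p => f p * f p) * (s * s) +
  integral_kform P (fun p => f p * g p) * (s * r + r * s) +
  integral_kform P (fun p => g p * g p) * (r * r).
Proof.
move=> cf cg; rewrite (_ : (fun p => _) = (fun p => (s * s) * (f p * f p) +
   ((s * r + r * s) * (f p * g p) + (r * r) * (g p * g p)))); last first.
  by apply/funext => p; ring.
have cff := chart_ctsM cf cf; have cfg := chart_ctsM cf cg; have cgg := chart_ctsM cg cg.
have crgg := chart_ctsM (chart_cts_cst (r * r)) cgg.
rewrite integral_kform_lin //; last first.
  exact: chart_ctsD (chart_ctsM (chart_cts_cst _) cfg) crgg.
rewrite integral_kform_lin // integral_kformZ //; ring.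
Qed.

(* The functions [half_exp u ^~ p] all solve the same linear equation of order
   two, so their Wronskians are constant and they span a space of dimension at
   most two. *)
Lemma half_exp_span I u (q : R -> R) : is_interval I -> I !=set0 ->
  jointly_smooth I u ->
  (forall t, I t -> forall p, half_exp'' u t p = - q t * half_exp u t p) ->
  exists (a b : M -> R) (f f' g g' : R -> R), [/\ chart_cts a, chart_cts b,
    forall t, I t -> [/\ is_derive t 1 f (f' t), is_derive t 1 f' (- q t * f t),
      is_derive t 1 g (g' t) & is_derive t 1 g' (- q t * g t)],
    forall t, I t -> forall p, half_exp u t p = a p * f t + b p * g t &
    forall t, I t -> forall p, half_exp' u t p = a p * f' t + b p * g' t].
Proof.
move=> itvI [t0 It0] su eqn.
have ch t : I t -> chart_cts (half_exp u t).
  move=> It; apply/chart_cts_expR/chart_ctsM; last exact: chart_cts_cst.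
  exact: jointly_smooth_chart_cts su It.
have ch' t : I t -> chart_cts (half_exp' u t).
  move=> It; apply: chart_ctsM; last exact: ch.
  apply: chart_ctsM; last exact: chart_cts_cst.
  exact: jointly_smooth_chart_cts (jointly_smooth_dt su) It.
(* The Wronskian of the solutions at [p1] and [p2]. *)
pose wr p1 p2 t := half_exp u t p1 * half_exp' u t p2 +
   -1 * (half_exp' u t p1 * half_exp u t p2).
have wr_cst p1 p2 t : I t -> wr p1 p2 t = wr p1 p2 t0.
  move=> It; apply: (deriv0_cst itvI) => // r Ir.
  have d1 := half_exp_deriv p1 su Ir; have d2 := half_exp_deriv p2 su Ir.
  have d1' := half_exp'_deriv p1 su Ir; have d2' := half_exp'_deriv p2 su Ir.
  apply: is_derive_eq (deriv_add (deriv_mul d1 d2') (deriv_scale (-1) (deriv_mul d1' d2))) _.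
  by rewrite !eqn //; ring.
have hd p t (It : I t) : is_derive t 1 (half_exp' u ^~ p) (- q t * half_exp u t p).
  by rewrite -eqn //; exact: half_exp'_deriv su It.
have [[p1 [p2 W12]]|deg] := pselect (exists p1 p2, wr p1 p2 t0 != 0).
  (* Cramer's rule in the basis formed by the solutions at [p1] and [p2]; the Wronskians may be
     taken at [t0] as they are constant. *)
  exists (fun p => wr p p2 t0 * (wr p1 p2 t0)^-1), (fun p => wr p1 p t0 * (wr p1 p2 t0)^-1).
  exists (half_exp u ^~ p1), (half_exp' u ^~ p1), (half_exp u ^~ p2), (half_exp' u ^~ p2).
  split.
  - apply: chart_ctsM; last exact: chart_cts_cst.
    apply: chart_ctsD.
      by apply: chart_ctsM; [exact: ch | exact: chart_cts_cst].
    apply: chart_ctsM; first exact: chart_cts_cst.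
    by apply: chart_ctsM; [exact: ch' | exact: chart_cts_cst].
  - apply: chart_ctsM; last exact: chart_cts_cst.
    apply: chart_ctsD.
      by apply: chart_ctsM; [exact: chart_cts_cst | exact: ch'].
    apply: chart_ctsM; first exact: chart_cts_cst.
    by apply: chart_ctsM; [exact: chart_cts_cst | exact: ch].
  - by move=> t It; split; [exact: half_exp_deriv su It | exact: hd |
      exact: half_exp_deriv su It | exact: hd].
  - move=> t It p; rewrite -!(wr_cst _ _ _ It) in W12 *.
    by rewrite /wr in W12 *; field.
  - move=> t It p; rewrite -!(wr_cst _ _ _ It) in W12 *.
    by rewrite /wr in W12 *; field.
(* All Wronskians vanish: u' is the same at all points, so every solution is a constant multiple of
   the one at [p1], and 0 serves as second generator. *)
have [p1 _] := carrier_neq0 M.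
have dtE p t : I t -> dt u t p = dt u t p1.
  move=> It; have [//|neq] := eqVneq (dt u t p) (dt u t p1).
  exfalso; apply: deg; exists p, p1; rewrite -(wr_cst _ _ _ It).
  rewrite (_ : wr p p1 t = half_exp u t p * half_exp u t p1 / 2 * (dt u t p1 - dt u t p)).
    apply: mulf_neq0; last by rewrite subr_eq0 eq_sym.
    by rewrite gt_eqF // divr_gt0 // mulr_gt0 // half_exp_gt0.
  by rewrite /wr /half_exp'; field.
pose a p := expR (u t0 p / 2 + - (u t0 p1 / 2)).
have hE p t : I t -> half_exp u t p = a p * half_exp u t p1.
  move=> It; rewrite /half_exp /a -expRD; congr expR.
  suff : u t p + -1 * u t p1 = u t0 p + -1 * u t0 p1 by lra.
  apply: (deriv0_cst (f := fun t => u t p + -1 * u t p1) itvI) => // r Ir.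
  have d := deriv_add (jointly_smooth_deriv p su Ir)
    (deriv_scale (-1) (jointly_smooth_deriv p1 su Ir)).
  by apply: is_derive_eq d _; rewrite (dtE p) //; ring.
exists a, (fun=> 0), (half_exp u ^~ p1), (half_exp' u ^~ p1), (cst 0), (cst 0); split.
- have cu := jointly_smooth_chart_cts su It0.
  apply/chart_cts_expR/chart_ctsD; last exact: chart_cts_cst.
  by apply: chart_ctsM => //; exact: chart_cts_cst.
- exact: chart_cts_cst.
- move=> t It; split; [exact: half_exp_deriv su It | exact: hd |
    exact: is_derive_cst | rewrite mulr0; exact: is_derive_cst].
- by move=> t It p; rewrite hE // mul0r addr0.
- by move=> t It p; rewrite /half_exp' hE // (dtE p) //; ring.
Qed.

Lemma chart_cts_half_exp' I u t :
  jointly_smooth I u -> I t -> chart_cts (half_exp' u t).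
Proof.
move=> su It; apply: chart_ctsM.
  apply: chart_ctsM; last exact: chart_cts_cst.
  exact: jointly_smooth_chart_cts (jointly_smooth_dt su) It.
apply/chart_cts_expR/chart_ctsM; last exact: chart_cts_cst.
exact: jointly_smooth_chart_cts su It.
Qed.

(** As w' = u' w / 2, the map from u to w = e^(u/2) is, up to the factor 2, an isometry of the
    Calabi metric into L^2. *)
Lemma calabi_half_exp I u t : jointly_smooth I u -> I t ->
  calabi P (u t) (dt u t) (dt u t) =
  4 * integral_kform P (fun p => half_exp' u t p ^+ 2).
Proof.
move=> su It; rewrite -integral_kformZ.
  congr integral_kform; apply/funext => p.
  by rewrite -half_exp_sqr /half_exp'; field.
by have ch' := chart_cts_half_exp' su It; exact: chart_ctsM.
Qed.

(* With [K] the squared [L^2] norm of the derivative and [G = Vol] that of the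
   solution itself, [G'' = 0] gives [K = q G], and then [K' = - q G' = 0]. *)
Lemma half_exp_energy I u (q : R -> R) : open I -> is_interval I -> I !=set0 ->
  smooth_curve P I u ->
  (forall t, I t -> forall p, half_exp'' u t p = - q t * half_exp u t p) ->
  (forall t, I t -> calabi P (u t) (dt u t) (dt u t) = 4 * q t * Vol P) /\
  (forall s t, I s -> I t -> q s = q t).
Proof.
move=> oI itvI I0 [Cu su] eqn.
have [a [b [f [f' [g [g' [ca cb fg wE w'E]]]]]]] := half_exp_span itvI I0 su eqn.
pose A := integral_kform P (fun p => a p * a p).
pose B := integral_kform P (fun p => a p * b p).
pose C := integral_kform P (fun p => b p * b p).
(* [Q f f g g], [Q f f' g g'] and [Q f' f' g' g'] are the integrals of w^2, w w' and w'^2. *)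
pose Q (x x' y y' : R -> R) t :=
  A * (x t * x' t) + B * (x t * y' t + y t * x' t) + C * (y t * y' t).
have GE t : I t -> Q f f g g t = Vol P.
  move=> It; have [_ <-] := Cu t It.
  rewrite [LHS](_ : _ = integral_kform P (fun p => (a p * f t + b p * g t) ^+ 2)).
    congr integral_kform; apply/funext => p.
    by rewrite -wE // half_exp_sqr.
  by rewrite integral_kform_quadratic.
have KE t : I t -> calabi P (u t) (dt u t) (dt u t) = 4 * Q f' f' g' g' t.
  move=> It; rewrite (calabi_half_exp su It); congr (_ * _).
  rewrite [RHS](_ : _ = integral_kform P (fun p => (a p * f' t + b p * g' t) ^+ 2)).
    by congr integral_kform; apply/funext => p; rewrite -w'E.
  by rewrite integral_kform_quadratic.
have H0 t : I t -> Q f f' g g' t = 0.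
  move=> It; have [df df' dg dg'] := fg t It.
  have := deriv_cst_on oI It GE (deriv_quadratic A B C df dg df dg).
  by rewrite /Q; lra.
(* The integral of w w' vanishes on [I], and its derivative is that of w'^2 minus [q t] times that
   of w^2. *)
have KqG t : I t -> Q f' f' g' g' t = q t * Vol P.
  move=> It; have [df df' dg dg'] := fg t It; rewrite -(GE t It).
  have := deriv_cst_on oI It H0 (deriv_quadratic A B C df dg df' dg').
  by rewrite /Q; lra.
split=> [t It|s t Is It]; first by rewrite KE // KqG // mulrA.
have Vol_neq0 : Vol P != 0 by rewrite gt_eqF // Vol_gt0.
(* Constancy of [q] is read off from that of q Vol = K, so [q] itself is never differentiated. *)
apply: (mulIf Vol_neq0); rewrite -!KqG //.
apply: (deriv0_cst itvI) => // r Ir; have [df df' dg dg'] := fg r Ir.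
apply: is_derive_eq (deriv_quadratic A B C df' dg' df' dg') _.
transitivity (- 2 * q r * Q f f' g g' r); last by rewrite H0 // mulr0.
by rewrite /Q; ring.
Qed.

(** Since w''/w = u''/2 + u'^2/4, the covariant derivative of u' is twice w''/w + q, where q is the
    squared speed divided by 4 Vol. *)
Lemma covD_half_exp u t p :
  covD P u (dt u) t p = 0 <->
  half_exp'' u t p =
    - (calabi P (u t) (dt u t) (dt u t) / (4 * Vol P)) * half_exp u t p.
Proof.
have Vol_neq0 : Vol P != 0 by rewrite gt_eqF // Vol_gt0.
rewrite /covD -/(calabi P (u t) (dt u t) (dt u t)) /half_exp''.
set E := calabi _ _ _ _.
have w_neq0 : half_exp u t p != 0 by rewrite gt_eqF // half_exp_gt0.
have cE : dt (dt u) t p + 2^-1 * dt u t p * dt u t p + (2 * Vol P)^-1 * E =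
  2 * ((dt (dt u) t p / 2 + dt u t p ^+ 2 / 4) - - (E / (4 * Vol P))) by field.
rewrite cE; split=> [|/(mulIf w_neq0) ->]; last by rewrite subrr mulr0.
by move/eqP; rewrite mulf_eq0 pnatr_eq0 /= subr_eq0 => /eqP ->.
Qed.

Lemma calabi_odeE I u (c : R) : open I -> jointly_smooth I u ->
  calabi_ode [set s | I (c * s)] (fun s => u (c * s)) <->
  (forall s, I (c * s) -> forall p,
     c ^+ 2 * half_exp'' u (c * s) p + half_exp u (c * s) p = 0).
Proof.
move=> oI su; split=> eqn s Ics p; have := eqn s Ics p.
  by rewrite -(derive2_half_exp p oI su Ics).
by rewrite -(derive2_half_exp p oI su Ics).
Qed.

End Geodesics.

(** * Geodesics and the differential equation *)

Theorem theorem1p2 (R : realType) (n : nat) (M : closedKaehlerManifold R n)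
    (P : @partition_of_unity R n M) (I : set R) (u : R -> M -> R)
    (I_open : open I) (I_interval : is_interval I) (I_neq0 : I !=set0)
    (u_curve : smooth_curve P I u) :
  ((geodesic P I u /\
      forall t, I t -> calabi P (u t) (dt u t) (dt u t) = 4 * Vol P) <->
   calabi_ode I u)
  /\
  ((geodesic P I u /\ ~ (forall s t, I s -> I t -> u s = u t)) <->
   exists c : R, 0 < c /\ calabi_ode [set s | I (c * s)] (fun s => u (c * s))).
Proof.
have VolP := Vol_gt0 P; have Vol_neq0 : Vol P != 0 by rewrite gt_eqF.
have su : jointly_smooth I u by case: u_curve.
pose E t := calabi P (u t) (dt u t) (dt u t).
have energy := half_exp_energy I_open I_interval I_neq0 u_curve.
(* Both claims follow from this equivalence: the first is the case c = 1, the second asks for some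
   c. *)
have scaled c : 0 < c ->
    calabi_ode [set s | I (c * s)] (fun s => u (c * s)) <->
    geodesic P I u /\ forall t, I t -> E t = 4 * c ^- 2 * Vol P.
  move=> c_gt0; have c_neq0 : c != 0 by rewrite gt_eqF.
  rewrite calabi_odeE //; split=> [eqn|[[_ geo] EE] s Ics p].
    have eqn' t : I t -> forall p, half_exp'' u t p = - c ^- 2 * half_exp u t p.
      (* Every [t] in [I] is reached by the rescaled curve, at time t / c. *)
      move=> It p; have tE : c * (c^-1 * t) = t by rewrite mulVKf.
      have := eqn (c^-1 * t); rewrite tE => /(_ It p) /eqP.
      rewrite addr_eq0 => /eqP ceq; apply: (mulfI (expf_neq0 2 c_neq0)).
      by rewrite ceq; field.
    have [EE _] := energy (fun=> c ^- 2) eqn'.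
    split; last exact: EE.
    split=> // t It p; apply/covD_half_exp.
    by rewrite eqn' // EE //; field; rewrite Vol_neq0.
  have /covD_half_exp -> := geo _ Ics p.
  by rewrite -/(E _) EE //; field; rewrite Vol_neq0.
split.
  have := scaled 1 ltr01; rewrite expr1n invr1 mulr1.
  rewrite (_ : (fun s => u (1 * s)) = u); last by apply/funext => s; rewrite mul1r.
  rewrite (_ : [set s | I (1 * s)] = I); last by apply/funext => s /=; rewrite mul1r.
  by move=> [h1 h2]; split.
split=> [[geo nonconst]|[c [c_gt0 /scaled [//|geo EE]]]]; last first.
  (* A constant curve has speed 0, whereas the squared speed here is 4 c^-2 Vol > 0. *)
  split=> // const; have [t0 It0] := I_neq0.
  have dt0 : dt u t0 = fun=> 0.
    apply/funext => p.
    apply: (deriv_cst_on (c := u t0 p) I_open It0 _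
      (jointly_smooth_deriv p su It0)).
    by move=> s Is; rewrite (const s t0).
  have E0 : E t0 = 0.
    rewrite -(mul0r (integral_kform P (fun=> 0))).
    rewrite -(integral_kformZ P 0 (@chart_cts_cst _ _ _ 0)) /E /calabi dt0.
    by congr integral_kform; apply/funext => p; rewrite !mul0r.
  have := EE t0 It0; rewrite E0 => /esym/eqP.
  by rewrite gt_eqF // !mulr_gt0 // invr_gt0 exprn_gt0.
have [_ geo'] := geo.
(* The geodesic equation is w'' = - q w with this [q], a priori depending on time; the energy lemma
   makes it constant. *)
have [_ Ecst] := energy (fun t => E t / (4 * Vol P))
  (fun t It p => (covD_half_exp P u t p).1 (geo' t It p)).
have [t0 It0] := I_neq0; pose q := E t0 / (4 * Vol P).
have Eq t : I t -> E t = 4 * q * Vol P.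
  by move=> It; rewrite /q -(Ecst t t0) //; field; rewrite Vol_neq0.
have E_ge0 : 0 <= E t0.
  rewrite /E (calabi_half_exp P su It0) mulr_ge0 //.
  by apply: integral_kform_ge0 => p; exact: sqr_ge0.
have : 0 <= q by rewrite divr_ge0 // mulr_ge0 // ltW.
rewrite le_eqVlt => /predU1P [q0|q_gt0].
  (* If q = 0, the integral of w'^2 is 0, so u' vanishes everywhere and the curve is constant. *)
  exfalso; apply: nonconst.
  have dt0 t p : I t -> dt u t p = 0.
    move=> It; apply: contrapT => /eqP dt_neq0.
    have := Eq t It; rewrite -q0 mulr0 mul0r /E (calabi_half_exp P su It) => /eqP.
    have ch' := chart_cts_half_exp' su It.
    rewrite mulf_eq0 pnatr_eq0 /= gt_eqF //.
    apply: (@integral_kform_gt0 _ _ _ _ _ p) => [|r|].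
    - exact: chart_ctsM.
    - exact: sqr_ge0.
    rewrite exprn_even_gt0 //=; apply: mulf_neq0.
      by rewrite mulf_neq0 // invr_eq0 pnatr_eq0.
    by rewrite gt_eqF // half_exp_gt0.
  move=> s t Is It; apply/funext => p.
  apply: (deriv0_cst (f := u ^~ p) I_interval) => // r Ir.
  by rewrite -(dt0 r p Ir); exact: jointly_smooth_deriv su Ir.
(* With this c, c^-2 = q. *)
exists (Num.sqrt q)^-1; split; first by rewrite invr_gt0 sqrtr_gt0.
apply/scaled; first by rewrite invr_gt0 sqrtr_gt0.
split=> // t It; rewrite Eq //; congr (_ * _ * _).
by rewrite exprVn invrK sqr_sqrtr // ltW.
Qed.
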